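(* There exists a frequency $\lambda=(\lambda_n)$ satisfying (BC) such that, for all integers $k\ge1$, one has $A(\lambda,k)=\frac{k-1}{2k}$ and, for $\sigma\in\mathbb R$, $T_\sigma$ maps $\mathcal H_2(\lambda)$ into $\mathcal H_{2k}(\lambda)$ if and only if $\sigma\ge\frac{k-1}{2k}$.
   Context: A frequency is a (strictly) increasing sequence $\lambda=(\lambda_n)_{n\ge1}$ of nonnegative real numbers tending to $+\infty$. A $\lambda$-Dirichlet series is a formal series $D=\sum_{n\ge1} a_n e^{-\lambda_n s}$, $a_n\in\mathbb C$. Condition (BC): there exist $\ell>0$ and $C>0$ such that $\lambda_{n+1}-\lambda_n\ge Ce^{-\ell\lambda_n}$ for all $n\in\mathbb N$. Hardy spaces: let $G$ be a compact abelian group (with normalized Haar measure) and $\beta:(\mathbb R,+)\to G$ a continuous homomorphism with dense range. $(G,\beta)$ is a $\lambda$-Dirichlet group if for every $n$ there is $h_{\lambda_n}\in\widehat G$ with $h_{\lambda_n}(\beta(t))=e^{-i\lambda_n t}$ for all $t\in\mathbb R$; such a group always exists. For $p\in[1,+\infty]$, $H_p^\lambda(G)$ is the subspace of $f\in L_p(G)$ with $\widehat f$ supported in $\{h_{\lambda_n}:n\in\mathbb N\}$. $\mathcal H_p(\lambda)$ is the space of all $\lambda$-Dirichlet series $\sum_n\widehat f(h_{\lambda_n})e^{-\lambda_ns}$, $f\in H_p^\lambda(G)$, with norm $\|\sum_n\widehat f(h_{\lambda_n})e^{-\lambda_ns}\|_p=\|f\|_p$; it does not depend on the chosen $\lambda$-Dirichlet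 group. For $p<\infty$ it is equivalently the completion of the $\lambda$-Dirichlet polynomials $D=\sum_{n=1}^Na_ne^{-\lambda_ns}$ under $\|D\|_p^p=\lim_{T\to+\infty}\frac1{2T}\int_{-T}^T|D(it)|^p\,dt$. The horizontal translation map is $T_\sigma\left(\sum_na_ne^{-\lambda_ns}\right)=\sum_na_ne^{-\sigma\lambda_n}e^{-\lambda_ns}$. For an integer $k\ge1$ let $\lambda^{*k}=\{\lambda_{n_1}+\cdots+\lambda_{n_k}\}$ be the set of all sums of $k$ terms of $\lambda$, enumerated as an increasing sequence $(\mu_l)$. Then $$A(\lambda,k)=\limsup_{l\to+\infty}\frac{\log\left(\mathrm{card}\{(n_1,\dots,n_k):\lambda_{n_1}+\cdots+\lambda_{n_k}=\mu_l\}\right)}{2\mu_l}.$$ *)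

(* Defs.v *)
From HB Require Import structures.
From mathcomp Require Import all_boot all_order all_algebra finmap.
From mathcomp Require Import complex.
From mathcomp Require Import all_classical all_reals all_analysis.

Set Implicit Arguments.
Unset Strict Implicit.
Unset Printing Implicit Defensive.

Import Order.TTheory GRing.Theory Num.Theory.
Import numFieldNormedType.Exports.

Local Open Scope classical_set_scope.
Local Open Scope ring_scope.

(* Sequences are indexed from 0: [lam n] is the (n+1)-st frequency, and a
   formal Dirichlet series is represented by its coefficients [nat -> R[i]]. *)

Section Frequencies.
Variable R : realType.
Implicit Type lam : nat -> R.

Definition frequency lam : Prop :=
  [/\ {homo lam : m n / (m < n)%N >-> m < n},
      (forall n, 0 <= lam n) &
      lam n @[n --> \oo] --> +oo].

Definition BC lam : Prop :=
  exists l C : R, [/\ 0 < l, 0 < C &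
    forall n, C * expR (- (l * lam n)) <= lam n.+1 - lam n].

Definition tuple_sum lam k (t : k.-tuple nat) : R := \sum_(i < k) lam (tnth t i).

Definition sumset lam k : set R := range (@tuple_sum lam k).

(* The increasing enumeration of [sumset lam k]: it exists and is unique when
   [lam] is a frequency and [0 < k]; otherwise the value may be junk. *)
Definition sumset_enum lam k : nat -> R :=
  xget (fun=> 0) [set mu : nat -> R |
    {homo mu : m n / (m < n)%N >-> m < n} /\ range mu = sumset lam k].

Definition rep_card lam k (x : R) : nat :=
  #|` fset_set [set t : k.-tuple nat | tuple_sum lam t = x]|.

Definition A lam k : \bar R :=
  limn_esup (fun l => (ln (rep_card lam k (sumset_enum lam k l))%:R
                       / (2 * sumset_enum lam k l))%:E).

Definition translation lam (sigma : R) (a : nat -> R[i]) : nat -> R[i] :=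
  fun n => a n * (expR (- (sigma * lam n)))%:C%C.

End Frequencies.

Definition pointed_group (G : topologicalZmodType) : Type := G.
HB.instance Definition _ (G : topologicalZmodType) :=
  Choice.on (pointed_group G).
HB.instance Definition _ (G : topologicalZmodType) :=
  isPointed.Build (pointed_group G) (0 : G).

(* [G] with its Borel sigma-algebra; measurable types must be pointed. *)
Notation borel G := (@g_sigma_algebraType (pointed_group G) (@open G)).

Section Hardy.
Variables (R : realType) (G : topologicalZmodType).

Definition haar (m : probability (borel G) R) : Prop :=
  [/\ (forall (x : G) (B : set (borel G)), measurable B ->
         m ((fun y : G => x + y) @^-1` B) = m B),
      (forall B : set (borel G), measurable B ->
         m B = ereal_inf [set m U | U in [set U : set G | open U /\ B `<=` U]]) &
      (forall B : set (borel G), measurable B ->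
         m B = ereal_sup [set m K | K in [set K : set G | compact K /\ K `<=` B]])].

Definition character (chi : G -> R[i]) : Prop :=
  [/\ continuous (chi : G -> R[i]^o),
      (forall x y, chi (x + y) = chi x * chi y) &
      (forall x, `|chi x| = 1)].

Definition expi (x : R) : R[i] := Complex (cos x) (sin x).

(* [lift_freq beta x chi] says that chi is the character $h_x$. *)
Definition lift_freq (beta : R -> G) (x : R) (chi : G -> R[i]) : Prop :=
  character chi /\ forall t, chi (beta t) = expi (- (x * t)).

Definition dirichlet_group (lam : nat -> R) (beta : R -> G) : Prop :=
  [/\ (hausdorff_space G /\ compact [set: G]),
      (continuous beta /\ (forall s t, beta (s + t) = beta s + beta t)),
      dense (range beta) &
      (forall n, exists chi, lift_freq beta (lam n) chi)].

Variable m : probability (borel G) R.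

Definition Lp (p : \bar R) (f : borel G -> R[i]) : Prop :=
  [/\ measurable_fun setT (fun x => complex.Re (f x)),
      measurable_fun setT (fun x => complex.Im (f x)) &
      (Lnorm m p (fun x => (Normc.normc (f x))%:E) < +oo)%E].

Definition cintegral (f : borel G -> R[i]) : R[i] :=
  Complex (\int[m]_x complex.Re (f x)) (\int[m]_x complex.Im (f x)).

Definition fourier (f : borel G -> R[i]) (chi : G -> R[i]) : R[i] :=
  cintegral (fun x => f x * conjc (chi x)).

Definition HpG (lam : nat -> R) (beta : R -> G) (p : \bar R)
    (f : borel G -> R[i]) : Prop :=
  Lp p f /\
  forall chi, character chi -> (forall n, ~ lift_freq beta (lam n) chi) ->
    fourier f chi = 0.

(* When [beta] has dense range, [lift_freq beta (lam n)] determines [chi]. *)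
Definition Hp (lam : nat -> R) (beta : R -> G) (p : \bar R) : set (nat -> R[i]) :=
  [set a | exists2 f, HpG lam beta p f &
     forall n chi, lift_freq beta (lam n) chi -> a n = fourier f chi].

End Hardy.

(* Main.v *)
(* The frequency is made of blocks.  The j-th block (y = j + 1) consists of
   about 2^(y^3) terms in arithmetic progression, starting at
   ln 2 * (y^3 + y^2) and of total length less than ln 2, with steps
   ln 2 * 2^(-y^3).  Thus a block of N terms sits at height log N + o(log N),
   but this height exceeds log N by about y^2 ln 2, so that
   sum_n exp(- lambda_n) <= 1.

   Number of representations of mu as a sum of k terms: a block alone gives
   about N^(k-1) representations of some mu close to k log N, by the pigeonhole
   principle; in the other direction, dropping a maximal term (at least mu / k)
   leaves k - 1 terms of sum at most mu (k-1)/k, and the bound on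
   sum_n exp(- lambda_n) shows that there are at most exp(mu (k-1)/k) of those.

   Translation, sufficiency: a polynomial Q with N terms satisfies
   |Q|_oo^2 <= N |Q|_2^2, hence |Q|_2k^2k <= N^(k-1) |Q|_2^2k.  For
   sigma >= (k-1)/2k the factor exp(- sigma lambda_n) compensates
   N^((k-1)/2k) on each block, with a surplus 2^(- sigma y^2), so that the blocks
   of the translated series are summable in L_2k.

   Translation, necessity: coefficients 2^(- y^3/2 - 2 y) on the j-th block give
   an element of H_2.  Pairing its translate with the Fejer kernel of the block,
   whose L_1 norm is 1 and whose maximum is of order N, bounds the L_2k norm from
   below by N^((k-1)/2k - sigma - o(1)), which is unbounded for
   sigma < (k-1)/2k. *)
Require Import Defs.
From mathcomp Require Import all_boot all_order all_algebra.
From mathcomp Require Import finmap complex.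
From mathcomp Require Import all_classical all_reals all_analysis.
From mathcomp Require Import measurable_realfun.
From mathcomp Require Import zify ring lra.

Set Implicit Arguments.
Unset Strict Implicit.
Unset Printing Implicit Defensive.

Import Order.TTheory GRing.Theory Num.Theory.
Import numFieldNormedType.Exports.
Local Open Scope classical_set_scope.
Local Open Scope ring_scope.

Local Notation Re := complex.Re.
Local Notation Im := complex.Im.
Local Notation normc := Normc.normc.

(** * The frequency *)

(* The j-th block is the set of indices n with [bnd j <= n < bnd j.+1]; [blk n]
   is the number of the block of n. *)
Definition bnd (i : nat) : nat := (2 ^ (i ^ 3)).-1.

Fixpoint blk (n : nat) : nat :=
  if n is n'.+1 then
    if n == bnd (blk n').+1 then (blk n').+1 else blk n'
  else 0%N.

Lemma bnd_lt : {homo bnd : i j / (i < j)%N}.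
Proof.
move=> i j ij; rewrite /bnd.
have : (2 ^ i ^ 3 < 2 ^ j ^ 3)%N by rewrite ltn_exp2l// ltn_exp2r.
by have : (0 < 2 ^ i ^ 3)%N; [rewrite expn_gt0|lia].
Qed.

Lemma bnd_le : {homo bnd : i j / (i <= j)%N}.
Proof. exact: (ltnW_homo bnd_lt). Qed.

Lemma leq_bnd n : (n <= bnd n)%N.
Proof. by elim: n => // n ih; have := bnd_lt (ltnSn n); lia. Qed.

Lemma blkP n : (bnd (blk n) <= n < bnd (blk n).+1)%N.
Proof.
elim: n => [|n /andP[ih1 ih2]] /=; first by [].
case: eqP => [->|ne]; last by apply/andP; split; lia.
by rewrite leqnn /= bnd_lt.
Qed.

Lemma blk_eq i n : (bnd i <= n < bnd i.+1)%N -> blk n = i.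
Proof.
move=> /andP[h1 h2]; have /andP[h3 h4] := blkP n.
apply/eqP; rewrite eqn_leq; apply/andP; split; rewrite leqNgt; apply/negP => h.
- by have := bnd_le h; lia.
- by have := bnd_le h; lia.
Qed.

Lemma blk_le : {homo blk : m n / (m <= n)%N}.
Proof.
move=> m n mn; rewrite leqNgt; apply/negP => h.
have /andP[h1 h2] := blkP n; have /andP[h3 h4] := blkP m.
by have := bnd_le h; lia.
Qed.

Lemma cubeS (i : nat) : (i.+1 ^ 3 = i ^ 3 + 3 * i ^ 2 + 3 * i + 1)%N.
Proof. by rewrite -addn1; ring. Qed.

Lemma sqrS (i : nat) : (i.+1 ^ 2 = i ^ 2 + 2 * i + 1)%N.
Proof. by rewrite -addn1; ring. Qed.

(* [ln 2 * hgt i] is the first frequency of block i. *)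
Definition hgt (i : nat) : nat := (i.+1 ^ 3 + i.+1 ^ 2)%N.

(** In units of [ln 2] a block has length less than 1, so at least 1 is left between the end of a
    block and the start of the next. *)
Lemma hgt_gap i : (hgt i + 2 <= hgt i.+1)%N.
Proof. by rewrite /hgt !cubeS !sqrS; move: (i ^ 3)%N (i ^ 2)%N => a b; lia. Qed.

Lemma bnd_size i : (bnd i.+1 - bnd i <= 2 ^ (i.+1 ^ 3))%N.
Proof. by rewrite /bnd; lia. Qed.

(** With M = 2^(y^3 - 2), y = i + 1, the sums of two offsets below M stay inside the block, as the
    squared kernel of [fejer_test] requires. For i = 0 the truncated subtraction gives M = 1, and
    the block is the single index 0. *)
Lemma bnd_room i : (bnd i + (2 ^ (i.+1 ^ 3 - 2)).*2.-1 <= bnd i.+1)%N.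
Proof.
case: i => [//|i]; rewrite /bnd.
have h : (i.+1 ^ 3 + 2 <= i.+2 ^ 3)%N.
  by rewrite !cubeS !sqrS; move: (i ^ 3)%N (i ^ 2)%N => a b; lia.
move: h; move: (i.+1 ^ 3)%N (i.+2 ^ 3)%N => a b ab.
have -> : b = (b - 2).+2 by lia.
rewrite !expnS subSS subSS subn0.
have : (2 ^ a <= 2 ^ (b - 2))%N by rewrite leq_exp2l//; lia.
have : (0 < 2 ^ a)%N by rewrite expn_gt0.
by move: (2 ^ a)%N (2 ^ (b - 2))%N => u v; lia.
Qed.

Section Freq.
Variable R : realType.
Local Notation L := (ln 2 : R).

Lemma ln2_gt0 : 0 < L. Proof. by apply: ln_gt0; rewrite ltr1n. Qed.

Lemma expR_L (n : nat) : expR (L * n%:R) = (2 ^ n)%:R :> R.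
Proof. by rewrite expRM_natr lnK ?posrE// natrX. Qed.

Lemma expR_LN (n : nat) : expR (- (L * n%:R)) = (2 ^ n)%:R^-1 :> R.
Proof. by rewrite expRN expR_L. Qed.

Definition freq (n : nat) : R :=
  L * ((hgt (blk n))%:R + (n - bnd (blk n))%:R / (2 ^ ((blk n).+1 ^ 3))%:R).

Lemma freqE i r : (bnd i + r < bnd i.+1)%N ->
  freq (bnd i + r) = L * ((hgt i)%:R + r%:R / (2 ^ (i.+1 ^ 3))%:R).
Proof.
move=> h; have e : blk (bnd i + r) = i by apply: blk_eq; rewrite leq_addr.
by rewrite /freq e addKn.
Qed.

Lemma freq_bounds n : L * (hgt (blk n))%:R <=
  freq n < L * ((hgt (blk n))%:R + 1).
Proof.
rewrite /freq ler_pM2l ?ln2_gt0// ltr_pM2l ?ln2_gt0// lerDl ltrD2l.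
have e0 : (0 < (2 ^ (blk n).+1 ^ 3)%:R :> R) by rewrite ltr0n expn_gt0.
rewrite divr_ge0 ?ler0n//= ltr_pdivrMr// mul1r ltr_nat.
have /andP[h1 h2] := blkP n; have := bnd_size (blk n); lia.
Qed.

(** Inside a block the step is [ln 2] times 2^(-y^3), and exp(- lambda_n) is at most 2^(-y^3)
    because the block starts at height at least [ln 2] times y^3. Between two blocks the gap is at
    least [ln 2]. *)
Lemma freq_gap n : L * expR (- freq n) <= freq n.+1 - freq n.
Proof.
have /andP[h1 h2] := blkP n; have /andP[l1 l2] := freq_bounds n.
have Lp := ln2_gt0.
have hexp : expR (- freq n) <= (2 ^ ((blk n).+1 ^ 3))%:R^-1.
  rewrite -expR_LN ler_expR lerN2 (le_trans _ l1)// ler_pM2l// ler_nat.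
  by rewrite /hgt leq_addr.
have [lt|ge] := ltnP n.+1 (bnd (blk n).+1).
- have e : blk n.+1 = blk n by apply: blk_eq; lia.
  rewrite /freq e -mulrBr ler_pM2l// (le_trans hexp)// subSn// -natr1.
  by rewrite le_eqVlt; apply/orP; left; apply/eqP; ring.
- have e : blk n.+1 = (blk n).+1.
    by apply: blk_eq; rewrite ge /=; have := bnd_lt (ltnSn (blk n).+1); lia.
  have /andP[] := freq_bounds n.+1; rewrite e => l3 _.
  apply: (@le_trans _ _ (L * 1)).
    rewrite ler_pM2l// (le_trans hexp)// invf_le1 ?ler1n ?ltr0n ?expn_gt0//.
  have : L * ((hgt (blk n))%:R + 2) <= L * (hgt (blk n).+1)%:R.
    by rewrite ler_pM2l// -natrD ler_nat hgt_gap.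
  by rewrite mulrDr mulrDr in l2 *; lra.
Qed.

Lemma freq_lt : {homo freq : m n / (m < n)%N >-> m < n}.
Proof.
apply: homo_ltn => [? ? ?|n]; first exact: lt_trans.
rewrite -subr_gt0 (lt_le_trans _ (freq_gap n))// mulr_gt0 ?ln2_gt0//.
exact: expR_gt0.
Qed.

Lemma freq_ge0 n : 0 <= freq n.
Proof.
have /andP[+ _] := freq_bounds n; apply: le_trans.
by rewrite mulr_ge0 ?ler0n// ltW ?ln2_gt0.
Qed.

Lemma freq_cvg : freq n @[n --> \oo] --> +oo.
Proof.
apply/cvgryPge => x.
near=> n.
have /andP[+ _] := freq_bounds n; apply: le_trans.
rewrite mulrC -ler_pdivrMr ?ln2_gt0//.
have : (bnd (Num.trunc `|x / L|).+1 <= n)%N by near: n; exact: nbhs_infty_ge.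
move=> /blk_le; rewrite (@blk_eq (Num.trunc `|x / L|).+1); last first.
  by rewrite leqnn /= bnd_lt.
move=> h; apply: (le_trans (ler_norm _)).
apply: (le_trans (ltW (truncnS_gt _))).
by rewrite ler_nat (leq_trans h)// /hgt !cubeS !sqrS;
  move: (_ ^ 3)%N (_ ^ 2)%N => a b; lia.
Unshelve. all: by end_near. Qed.

Lemma frequency_freq : frequency freq.
Proof. split; [exact: freq_lt|exact: freq_ge0|exact: freq_cvg]. Qed.

Lemma BC_freq : BC freq.
Proof.
exists 1, L; split; [exact: ltr01|exact: ln2_gt0|move=> n].
by rewrite mul1r freq_gap.
Qed.

Lemma sum_blocks (V : nmodType) (F : nat -> V) I :
  \sum_(0 <= n < bnd I) F n =
  \sum_(0 <= i < I) \sum_(bnd i <= n < bnd i.+1) F n.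
Proof.
elim: I => [|I ih]; first by rewrite !big_geq.
rewrite big_nat_recr//= -ih -big_cat_nat//=.
by apply: bnd_le.
Qed.

Lemma sum_geo2 n : \sum_(0 <= i < n) (2 ^ i.+1)%:R^-1 = 1 - (2 ^ n)%:R^-1 :> R.
Proof.
elim: n => [|n ih]; first by rewrite big_geq// invr1 subrr.
rewrite big_nat_recr//= ih !natrX exprS; field.
by rewrite expf_eq0 pnatr_eq0 andbF.
Qed.

(** Block i has at most 2^(y^3) terms, each at most 2^(-y^3-y^2), where y = i + 1. It contributes at
    most 2^(-y^2) <= 2^(-y), and these bounds sum to at most 1. The constant 1 keeps products of
    such sums bounded by 1 in [rep_card_upper]. *)
Lemma sum_expR_freq N : \sum_(0 <= n < N) expR (- freq n) <= 1.
Proof.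
apply: (@le_trans _ _ (\sum_(0 <= n < bnd N) expR (- freq n))).
  rewrite [leRHS](big_cat_nat (leq0n N) (leq_bnd N))/= lerDl sumr_ge0//.
rewrite sum_blocks.
apply: (@le_trans _ _ (\sum_(0 <= i < N) (2 ^ i.+1)%:R^-1)); last first.
  by rewrite sum_geo2 lerBlDr lerDl invr_ge0 ler0n.
apply: ler_sum_nat => i _.
apply: (@le_trans _ _ (\sum_(bnd i <= n < bnd i.+1) (2 ^ hgt i)%:R^-1)).
  apply: ler_sum_nat => n /blk_eq e.
  rewrite -expR_LN ler_expR lerN2 -e.
  by have /andP[] := freq_bounds n.
rewrite big_const_nat iter_addr addr0 -[_ *+ _]mulr_natr.
rewrite ler_pdivrMl ?ltr0n ?expn_gt0//.
rewrite ler_pdivlMr ?ltr0n ?expn_gt0//.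
rewrite -natrM ler_nat /hgt expnD leq_mul ?bnd_size//.
by rewrite leq_exp2l//; rewrite sqrS; move: (i ^ 2)%N => a; lia.
Qed.

End Freq.

(** * Sums of k terms and their multiplicities *)

Section Enum.
Variable R : realType.

Lemma finite_set_min (F : set R) : finite_set F -> F !=set0 ->
  exists2 x, F x & forall y, F y -> x <= y.
Proof.
move=> /finite_seqP[s ->] [x0 /= x0s].
elim: s x0 x0s => // a s ih x0 _.
case: s ih => [_|b s ih].
  by exists a => [|y]; rewrite /= inE// => /eqP ->.
have [x xs xle] := ih b (mem_head _ _).
have [ax|xa] := leP a x.
  exists a => [|y /=]; first exact: mem_head.
  by rewrite inE => /orP[/eqP ->//|/xle]; exact: le_trans.
exists x => [|y /=]; first by rewrite /= inE xs orbT.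
by rewrite inE => /orP[/eqP ->|/xle//]; exact: ltW.
Qed.

(** The enumeration iterates the successor map of [S] from its minimum. An element missed by it
    would lie above every term, putting infinitely many elements of [S] below a fixed bound. *)
Lemma increasing_enumeration (S : set R) :
  (forall x, finite_set (S `&` [set s | s <= x])) ->
  (forall x, exists2 s, S s & x < s) ->
  exists mu : nat -> R, {homo mu : m n / (m < n)%N >-> m < n} /\ range mu = S.
Proof.
move=> fin unb.
have next x : exists y, [/\ S y, x < y & forall z, S z -> x < z -> y <= z].
  have [s Ss xs] := unb x.
  have [||y [[Sy ys] xy] ymin] :=
    @finite_set_min ((S `&` [set z | z <= s]) `&` [set z | x < z]).
  - exact: finite_setIl.
  - by exists s; split=> //; split=> //=.
  - exists y; split=> // z Sz xz; have [zs|sz] := leP z s; first exact: ymin.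
    exact: le_trans ys (ltW sz).
have first : exists2 y, S y & forall z, S z -> y <= z.
  have [s Ss _] := unb 0.
  have [||y [Sy ys] ymin] := @finite_set_min (S `&` [set z | z <= s]).
  - exact: fin.
  - by exists s; split=> //=.
  - exists y => // z Sz; have [zs|sz] := leP z s; first exact: ymin.
    exact: le_trans ys (ltW sz).
have [f fP] := choice next; case: first => y0 Sy0 y0min.
pose mu n := iter n f y0.
have muS n : S (mu n) by case: n => [|n] //=; have [] := fP (mu n).
have mulf : {homo mu : m n / (m < n)%N >-> m < n}.
  by apply: homo_ltn => [? ? ?|n]; [exact: lt_trans|have [] := fP (mu n)].
exists mu; split=> //; apply/seteqP; split=> [_ [n _ <-]//|s Ss].
apply: contrapT => nrange.
have mule n : mu n <= s.
  elim: n => [|n ih]; first exact: y0min.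
  have [_ _] := fP (mu n); apply => //; rewrite lt_neqAle ih andbT.
  by apply/eqP => e; apply: nrange; exists n.
have muinj : injective mu := inc_inj (le_mono mulf).
have : finite_set (mu @^-1` (S `&` [set z | z <= s])).
  by apply: finite_preimage => // m n _ _; exact: muinj.
suff -> : mu @^-1` (S `&` [set z | z <= s]) = setT by exact: infinite_nat.
by apply/seteqP; split=> // n _; split=> //=.
Qed.
End Enum.

(** * Counting the tuples with a given sum *)

Section Rep.
Variables (R : realType) (lam : nat -> R).
Hypothesis flam : frequency lam.

Lemma frequency_le_inj (m n : nat) : (lam m <= lam n) = (m <= n)%N.
Proof. by case: flam => inc _ _; exact: (le_mono inc). Qed.

Lemma tuple_le_sum k (t : k.-tuple nat) i : lam (tnth t i) <= tuple_sum lam t.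
Proof.
rewrite /tuple_sum (bigD1 i)//= lerDl sumr_ge0// => j _.
by case: flam.
Qed.

Lemma frequency_unbounded x : exists n, x < lam n.
Proof.
case: flam => _ _ /cvgryPgt/(_ x)[n _ nP]; exists n; apply: nP => /=;
  exact: leqnn.
Qed.

Lemma bounded_tuples k x : exists N : nat, forall t : k.-tuple nat,
  tuple_sum lam t <= x -> forall i, (tnth t i < N.+1)%N.
Proof.
have [N xN] := frequency_unbounded x; exists N => t tx i.
rewrite ltnS -frequency_le_inj ltW// (le_lt_trans _ xN)//.
exact: le_trans (tuple_le_sum _ _) tx.
Qed.

(** Encodes the tuples with entries in the interval [s, s + N) by a finite type, so that they can be
    counted. The offset is 0 for upper bounds and the start of a block for lower bounds. *)
Definition shift_tuple (k N s : nat) (f : {ffun 'I_k -> 'I_N}) : k.-tuple nat :=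
  mktuple (fun i => (s + f i)%N).

Lemma shift_tuple_inj k N s : injective (@shift_tuple k N s).
Proof.
move=> f g fg; apply/ffunP => i; apply/val_inj.
have := congr1 (fun t => tnth t i) fg.
by rewrite !tnth_mktuple => /addnI.
Qed.

Lemma shift_tupleE k N (t : k.-tuple nat) : (forall i, (tnth t i < N.+1)%N) ->
  t = @shift_tuple k N.+1 0 [ffun i => inord (tnth t i)].
Proof.
by move=> h; apply: eq_from_tnth => i; rewrite tnth_mktuple ffunE add0n inordK.
Qed.

Lemma finite_tuples k x :
  finite_set [set t : k.-tuple nat | tuple_sum lam t <= x].
Proof.
have [N NP] := bounded_tuples k x.
apply: (@sub_finite_set _ _ (range (@shift_tuple k N.+1 0))); last first.
  exact: finite_image.
by move=> t /= /NP/shift_tupleE e; exists [ffun i => inord (tnth t i)].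
Qed.

(** [fset_set] is empty by default on an infinite set; finiteness makes [rep_card] a genuine
    count. *)
Lemma finite_fiber k x :
  finite_set [set t : k.-tuple nat | tuple_sum lam t = x].
Proof. by apply: sub_finite_set (finite_tuples k x) => t /= ->. Qed.

Lemma rep_card_ge k N s x (P : pred {ffun 'I_k -> 'I_N}) :
  (forall f, P f -> tuple_sum lam (@shift_tuple k N s f) = x) ->
  (#|P| <= rep_card lam k x)%N.
Proof.
move=> h; rewrite /rep_card cardE -(size_map (@shift_tuple k N s)).
apply: uniq_leq_size; first by rewrite map_inj_uniq ?enum_uniq//;
  exact: shift_tuple_inj.
move=> _ /mapP[f fP ->]; rewrite mem_enum in fP.
by rewrite in_fset_set ?inE//=; [exact: h|exact: finite_fiber].
Qed.

Lemma rep_card_le k N x :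
  (forall t : k.-tuple nat, tuple_sum lam t <= x ->
    forall i, (tnth t i < N.+1)%N) ->
  (rep_card lam k x <=
    #|[pred f | tuple_sum lam (@shift_tuple k N.+1 0 f) == x]|)%N.
Proof.
move=> NP; rewrite /rep_card [leqRHS]cardE -(size_map (@shift_tuple k N.+1 0)).
apply: uniq_leq_size; first exact: fset_uniq.
move=> t; rewrite in_fset_set; last exact: finite_fiber.
rewrite inE /= => tx.
have tN : forall i, (tnth t i < N.+1)%N by apply: NP; rewrite tx.
have e := shift_tupleE tN.
rewrite e; apply/mapP; exists [ffun i => inord (tnth t i)] => //.
by rewrite mem_enum inE -e tx.
Qed.

(** The [xget] of the definition therefore never returns its default value: sums below a bound come
    from finitely many tuples, and constant tuples have arbitrarily large sums. *)
Lemma sumset_enumP k : (0 < k)%N ->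
  {homo sumset_enum lam k : m n / (m < n)%N >-> m < n} /\
  range (sumset_enum lam k) = sumset lam k.
Proof.
move=> k0; rewrite /sumset_enum; case: xgetP => [y _ //|/= nex].
exfalso.
have [||mu muP] := @increasing_enumeration R (sumset lam k).
- move=> x; apply: (@sub_finite_set _ _
    (tuple_sum lam (k:=k) @` [set t | tuple_sum lam t <= x])).
    by move=> _ [[t _ <-] tx]; exists t.
  by apply: finite_image; exact: finite_tuples.
- move=> x; have [n xn] := frequency_unbounded x.
  exists (tuple_sum lam [tuple n | i < k]); first by exists [tuple n | i < k].
  rewrite (lt_le_trans xn)// -[in leLHS](tnth_mktuple (fun=> n) (Ordinal k0)).
  exact: tuple_le_sum.
- exact: nex muP.
Qed.

End Rep.

(** [limn_esup] is an infimum, over neighbourhoods of infinity, of suprema: the first hypothesis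
    bounds one of these suprema from above, the second bounds all of them from below. *)
Lemma limn_esup_eq (R : realType) (u : nat -> R) (c : R) :
  (forall e, 0 < e -> exists N : nat, forall n, (N <= n)%N -> u n <= c + e) ->
  (forall e N, 0 < e -> exists2 n, (N <= n)%N & c - e <= u n) ->
  limn_esup (fun n => (u n)%:E) = c%:E.
Proof.
move=> ub lb; apply/eqP; rewrite eq_le; apply/andP; split.
- apply/lee_addgt0Pr => e e0; have [N NP] := ub e e0.
  apply: (@le_trans _ _
    (ereal_sup ((fun n => (u n)%:E) @` [set n | (N <= n)%N]))).
    by apply: ereal_inf_lbound; exists [set n | (N <= n)%N] => //; exists N.
  by apply: ge_ereal_sup => _ [n /= Nn <-]; rewrite -EFinD lee_fin NP.
- apply: le_ereal_inf_tmp => _ [B [N _ NB] <-].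
  apply/lee_subgt0Pr => e e0; have [n Nn un] := lb e N e0.
  apply: (@le_trans _ _ (u n)%:E); first by rewrite -EFinB lee_fin.
  by apply: ereal_sup_ubound; exists n => //; exact: NB.
Qed.

(** * Upper bound for the multiplicities *)

Section Upper.
Variables (R : realType) (lam : nat -> R).
Hypothesis flam : frequency lam.
Hypothesis slam : forall N, \sum_(0 <= n < N) expR (- lam n) <= 1.

(* Rankin's trick, after discarding a maximal coordinate *)
Lemma rep_card_upper k x : (0 < k)%N ->
  (rep_card lam k x)%:R <= k%:R * expR (x * ((k%:R - 1) / k%:R)).
Proof.
move=> k0; have kp : 0 < k%:R :> R by rewrite ltr0n.
have [N NP] := bounded_tuples flam k x.
have := rep_card_le flam NP.
set P := [pred f | _]; rewrite -(ler_nat R) => /le_trans; apply.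
pose E := expR (x * ((k%:R - 1) / k%:R)).
pose W (f : {ffun 'I_k -> 'I_N.+1}) (i : 'I_k) :=
  \prod_(j | j != i) expR (- lam (f j)).
have W0 f i : 0 <= W f i by apply: prodr_ge0 => j _; exact: expR_ge0.
have sumW f : P f -> \sum_j lam (f j) = x.
  move=> /eqP <-; rewrite /tuple_sum; apply: eq_bigr => j _.
  by rewrite tnth_mktuple add0n.
(* Some coordinate i is at least the mean x / k, so the others sum to at most x (k-1)/k and already
   [E * W f i] is at least 1. *)
have step1 f : P f -> 1 <= \sum_i E * W f i.
  move=> Pf; have [i xi] : exists i, x / k%:R <= lam (f i).
    apply: contrapT => /forallNP h.
    suff : x < x by rewrite ltxx.
    rewrite -{1}(sumW f Pf).
    have -> : x = \sum_(j < k) x / k%:R.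
      by rewrite sumr_const card_ord -[RHS]mulr_natr divfK// gt_eqF.
    apply: ltr_sum => [|i _]; last by rewrite ltNge; exact/negP/h.
    by apply/hasP; exists (Ordinal k0) => //; rewrite mem_index_enum.
  rewrite (bigD1 i)//=.
  apply: (@le_trans _ _ (E * W f i)); last first.
    by rewrite lerDl; apply: sumr_ge0 => j _; rewrite mulr_ge0// expR_ge0.
  rewrite /W -expR_sum -expRD -[leLHS]expR0 ler_expR sumrN.
  have : \sum_(j | j != i) lam (f j) = x - lam (f i).
    by rewrite -(sumW f Pf) [in RHS](bigD1 i)//= addrC addrK.
  move=> ->; have -> : x * ((k%:R - 1) / k%:R) = x - x / k%:R.
    by field; rewrite gt_eqF.
  by lra.
(* The sum x and the other coordinates determine the i-th one, so resetting it to 0 is injective on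
   [P]. With the indicator of 0 as i-th factor, the sum over all functions factors into sums that
   are each at most 1. *)
have step2 i : \sum_(f in P) W f i <= 1.
  pose u (f : {ffun 'I_k -> 'I_N.+1}) :=
    [ffun j => if j == i then ord0 else f j].
  pose F (j : 'I_k) (n : 'I_N.+1) : R :=
    if j == i then (n == ord0)%:R else expR (- lam n).
  have F0 j n : 0 <= F j n by rewrite /F; case: ifP => // _; exact: expR_ge0.
  have uinj : {in [set f in P] &, injective u}%SET.
    move=> f g; rewrite !inE => Pf Pg ufg.
    have fg j : j != i -> f j = g j.
      by move=> ji; have := congr1 (fun h : {ffun _} => h j) ufg;
         rewrite !ffunE (negbTE ji).
    apply/ffunP => j; have [->|/fg//] := eqVneq j i.
    apply/val_inj/eqP; rewrite eqn_leq -!(frequency_le_inj flam) -eq_le.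
    have := sumW f Pf; rewrite -(sumW g Pg) (bigD1 i)//= [RHS](bigD1 i)//=.
    rewrite (eq_bigr (fun j => lam (g j))); last by move=> l /fg ->.
    by move=> /addIr ->.
  have -> : \sum_(f in P) W f i =
    \sum_(f in [set f in P]%SET) \prod_j F j (u f j).
    apply: eq_big => f; first by rewrite inE.
    move=> _; rewrite /W [RHS](bigD1 i)//= {1}/F ffunE !eqxx mul1r.
    by apply: eq_bigr => j ji; rewrite /F ffunE (negbTE ji).
  rewrite -(big_imset (fun g : {ffun 'I_k -> 'I_N.+1} => \prod_j F j (g j)))//=.
  apply: (@le_trans _ _ (\sum_(g : {ffun 'I_k -> 'I_N.+1}) \prod_j F j (g j))).
    rewrite [leLHS]big_mkcond; apply: ler_sum => g _; case: ifP => // _.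
    by apply: prodr_ge0.
  rewrite -bigA_distr_bigA; apply: prodr_ile1 => j _; rewrite sumr_ge0//=.
  rewrite /F; case: eqP => _.
    by rewrite (bigD1 ord0)//= big1 ?addr0// => n /negbTE ->.
  by rewrite -(big_mkord xpredT (fun n => expR (- lam n))).
rewrite -sum1_card natr_sum.
apply: (@le_trans _ _ (\sum_(f in P) \sum_i E * W f i)).
  by apply: ler_sum => f; exact: step1.
rewrite exchange_big /=.
apply: (@le_trans _ _ (\sum_(i < k) E)).
  apply: ler_sum => i _; rewrite -mulr_sumr ler_piMr ?expR_ge0//.
by rewrite sumr_const card_ord -[leLHS]mulr_natl.
Qed.

End Upper.

(** * The value of A for the constructed frequency *)

Section ALam.
Variable R : realType.
Local Notation L := (ln 2 : R).
Local Notation lam := (@freq R).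

(** Since a block is an arithmetic progression, the sum of a tuple in it depends only on the sum of
    the offsets. The M^k choices of offsets below M give fewer than k M + 1 values of that sum, so
    one value is taken at least M^(k-1)/k times. *)
Lemma rep_card_lower k i : (0 < k)%N -> let M := (2 ^ (i.+1 ^ 3 - 2))%N in
  exists2 x, sumset lam k x & x <= k%:R * (L * ((hgt i)%:R + 1)) /\
   (L * (k%:R * (hgt i)%:R) <= x /\ (M ^ k.-1 <= k * rep_card lam k x)%N).
Proof.
move=> k0 M; have M0 : (0 < M)%N by rewrite expn_gt0.
have MW : (M <= 2 ^ i.+1 ^ 3)%N by rewrite leq_exp2l// leq_subr.
have room j : (j < M)%N -> (bnd i + j < bnd i.+1)%N.
  by move=> jM; have := bnd_room i; rewrite -/M; lia.
pose T := {ffun 'I_k -> 'I_M}.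
pose S (f : T) := (\sum_j f j)%N.
have SP f : (S f < k * M)%N.
  have : (S f <= \sum_(j < k) M.-1)%N by apply: leq_sum => j _;
    have := ltn_ord (f j); lia.
  by rewrite sum_nat_const card_ord; nia.
pose p f : 'I_(k * M) := Ordinal (SP f).
have [s sP] : exists s : 'I_(k * M), (M ^ k.-1 <= k * #|[pred f | p f == s]|)%N.
  apply: contrapT => /forallNP h.
  have hs (s : 'I_(k * M)) : (k * #|[pred f | p f == s]| < M ^ k.-1)%N.
    by rewrite ltnNge; apply/negP/h.
  have : (k * #|{: T}| < \sum_(s < k * M) M ^ k.-1)%N.
    rewrite -sum1_card (partition_big p xpredT)//= big_distrr /=.
    have s0 : 'I_(k * M) by exists 0%N; rewrite muln_gt0 k0.
    rewrite (bigD1 s0)//= [ltnRHS](bigD1 s0)//= -addSn leq_add//.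
      by rewrite sum1_card; exact: hs.
    by apply: leq_sum => s _; rewrite sum1_card; exact/ltnW/hs.
  rewrite card_ffun !card_ord sum_nat_const card_ord -mulnA -expnS prednK//.
  by rewrite ltnn.
have val f : (p f == s) ->
    tuple_sum lam (@shift_tuple k M (bnd i) f) =
    L * (k%:R * (hgt i)%:R + s%:R / (2 ^ (i.+1 ^ 3))%:R).
  move=> /eqP <-; rewrite /tuple_sum /= /S natr_sum.
  under eq_bigr => j _ do rewrite tnth_mktuple freqE ?room ?ltn_ord//.
  by rewrite -mulr_sumr big_split/=
    sumr_const card_ord mulr_suml -[_ *+ k]mulr_natl.
exists (L * (k%:R * (hgt i)%:R + s%:R / (2 ^ (i.+1 ^ 3))%:R)).
  have : (0 < k * #|[pred f | p f == s]|)%N.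
    by rewrite (leq_trans _ sP)// expn_gt0 M0.
  rewrite muln_gt0 k0/= => /card_gt0P[f]; rewrite inE => /val <-.
  by exists (@shift_tuple k M (bnd i) f).
split.
  rewrite [leRHS]mulrCA ler_pM2l ?ln2_gt0// mulrDr mulr1 lerD2l.
  rewrite ler_pdivrMr ?ltr0n ?expn_gt0// -natrM ler_nat.
  by rewrite (leq_trans (ltnW (ltn_ord s)))// leq_mul2l MW orbT.
split.
  by rewrite ler_pM2l ?ln2_gt0// lerDl divr_ge0.
rewrite (leq_trans sP)// leq_mul2l; apply/orP; right.
apply: (@rep_card_ge _ _ (frequency_freq R) _ _ (bnd i)).
by move=> f /= /val.
Qed.


Lemma A_freq k : (0 < k)%N -> A lam k = ((k%:R - 1) / (2 * k%:R))%:E.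
Proof.
move=> k0; have kp : 0 < k%:R :> R by rewrite ltr0n.
have kp1 : 1 <= k%:R :> R by rewrite ler1n.
have flam := frequency_freq R.
have [muinc murange] := sumset_enumP flam k0.
set mu := sumset_enum lam k in muinc murange *.
have Lp := ln2_gt0 R.
(* Positivity of the count keeps [ln] away from its default value at 0. *)
have repgt0 l : (0 < rep_card lam k (mu l))%N.
  have [t _ tl] : sumset lam k (mu l) by rewrite -murange; exists l.
  have [N NP] := bounded_tuples flam k (mu l).
  have := NP t; rewrite tl => /(_ (lexx _)) tN.
  have tE := shift_tupleE tN.
  apply: leq_trans (@rep_card_ge _ _ flam k N.+1 0 (mu l)
     (pred1 [ffun i => inord (tnth t i)]) _).
    by rewrite card1.
  by move=> f /eqP ->; rewrite -tE.
have muge x : exists l, x <= mu l.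
  have [n xn] := frequency_unbounded flam x.
  have [l _ lE] : range mu (tuple_sum lam [tuple n | i < k]).
    by rewrite murange; exists [tuple n | i < k].
  exists l; rewrite lE (le_trans (ltW xn))//.
  rewrite -[in leLHS](tnth_mktuple (fun=> n) (Ordinal k0)).
  exact: tuple_le_sum.
have mule : {homo mu : m n / (m <= n)%N >-> m <= n}.
  by move=> m n mn; rewrite (le_mono muinc).
apply: limn_esup_eq => [e e0|e N e0].
(* The summand 1 makes [mu n] positive; the other makes [ln k] at most 2 e [mu n], which absorbs the
   factor k of [rep_card_upper]. *)
- have [N NP] := muge (1 + `|ln k%:R| / (2 * e)); exists N => n /mule Nn.
  have munp : 0 < mu n.
    apply: lt_le_trans (le_trans NP Nn).
    by rewrite ltr_pwDl// divr_ge0// mulr_ge0// ltW.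
  rewrite ler_pdivrMr ?mulr_gt0//.
  have := rep_card_upper flam (sum_expR_freq R) (mu n) k0.
  rewrite -ler_ln ?posrE ?ltr0n ?repgt0// ?mulr_gt0 ?expR_gt0//.
  rewrite lnM ?posrE ?expR_gt0// expRK => /le_trans; apply.
  have -> : ((k%:R - 1) / (2 * k%:R) + e) * (2 * mu n) =
     e * (2 * mu n) + mu n * ((k%:R - 1) / k%:R) by field; rewrite gt_eqF.
  rewrite lerD2r (le_trans (ler_norm _))//.
  have -> : e * (2 * mu n) = mu n * (2 * e) by ring.
  rewrite -ler_pdivrMr ?mulr_gt0//.
  by rewrite (le_trans _ (le_trans NP Nn))// lerDr.
- pose c : R := (k%:R - 1) / (2 * k%:R).
  have c0 : 0 <= c by rewrite divr_ge0 ?subr_ge0// mulr_ge0// ltW.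
  (* If e > c the target is negative and every term of the sequence exceeds it. Otherwise c - e >=
     0, so an upper bound on [x] may be multiplied by c - e. *)
  have [ec|ec] := leP e c; last first.
    exists N => //; rewrite (@le_trans _ _ 0)//; first by rewrite subr_le0 ltW.
    apply: divr_ge0; first by rewrite ln_ge0// ler1n repgt0.
    have [t _ tN] : sumset lam k (mu N) by rewrite -murange; exists N.
    by rewrite mulr_ge0// -/mu -tN sumr_ge0// => i _; exact: freq_ge0.
  (* The block is taken far enough for two purposes: the first term of [i] lets e times a cubic in Y
     dominate the quadratic errors collected in [D]; the second puts [x] above [mu N], so that its
     index is at least N. *)
  pose D := 4 * k%:R + `|ln k%:R| / L.
  have ke : 0 < 2 * k%:R * e by rewrite !mulr_gt0.
  pose i := Num.trunc (D / (2 * k%:R * e) + `|mu N| / L).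
  have [x Sx [xle [xge repx]]] := rep_card_lower i k0.
  have [n _ nx] : range mu x by rewrite murange.
  have D0 : 0 <= D by rewrite addr_ge0// ?divr_ge0// ?mulr_ge0// ltW.
  have iP : D / (2 * k%:R * e) + `|mu N| / L <= i.+1%:R by rewrite ltW//
    truncnS_gt.
  set Y : R := i.+1%:R in iP.
  have Y1 : 1 <= Y by rewrite ler1n.
  have YD : D <= Y * (2 * k%:R * e).
    rewrite -ler_pdivrMr//; apply: le_trans iP.
    by rewrite lerDl divr_ge0// ltW.
  have YN : `|mu N| <= Y * L.
    rewrite -ler_pdivrMr//; apply: le_trans iP.
    by rewrite lerDr divr_ge0// ltW.
  have hE : (hgt i)%:R = Y ^+ 3 + Y ^+ 2 :> R by rewrite /hgt natrD !natrX.
  have Y2 : 1 <= Y ^+ 2 by rewrite exprn_ege1.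
  have Y3 : Y <= Y ^+ 3 by rewrite exprS ler_peMr// ltW// (lt_le_trans ltr01).
  have xY : Y * L <= x.
    apply: le_trans xge; rewrite mulrC ler_pM2l// hE.
    apply: (@le_trans _ _ (Y ^+ 3 + Y ^+ 2)); first by lra.
    by rewrite ler_peMl//; lra.
  have x0 : 0 < x by apply: lt_le_trans xY;
    rewrite mulr_gt0// (lt_le_trans ltr01).
  exists n.
    rewrite leqNgt; apply/negP => /muinc; rewrite nx ltNge => /negP; apply.
    exact: le_trans (ler_norm _) (le_trans YN xY).
  rewrite -/mu nx ler_pdivlMr ?mulr_gt0//.
  have lnrep : (k%:R - 1) * (L * (Y ^+ 3 - 2)) <=
    ln k%:R + ln (rep_card lam k x)%:R.
    have r0 : (0 < rep_card lam k x)%N by rewrite -nx.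
    rewrite -lnM ?posrE ?ltr0n// -natrM.
    have M0 : (0 < 2 ^ (i.+1 ^ 3 - 2))%N by rewrite expn_gt0.
    apply: (@le_trans _ _ (ln ((2 ^ (i.+1 ^ 3 - 2)) ^ k.-1)%:R)); last first.
      by rewrite ler_ln ?posrE ?ltr0n ?expn_gt0 ?M0 ?muln_gt0 ?k0// ler_nat.
    rewrite natrX lnXn ?ltr0n// natrX lnXn// -[leRHS]mulr_natl.
    have -> : k.-1%:R = k%:R - 1 :> R
      by rewrite -[in RHS](prednK k0) -natr1 addrK.
    rewrite ler_wpM2l ?subr_ge0// -[leRHS]mulr_natr ler_pM2l//.
    by rewrite lerBlDr -natrX -natrD ler_nat addnC -leq_subLR.
  have lnk := ler_norm (ln k%:R : R).
  rewrite -/c.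
  have cE : c * (2 * k%:R) = k%:R - 1 by rewrite /c divfK// gt_eqF// mulr_gt0.
  have step : (c - e) * (2 * x) <=
    (c - e) * (2 * (k%:R * (L * (Y ^+ 3 + Y ^+ 2 + 1)))).
    by rewrite ler_wpM2l ?subr_ge0// ler_pM2l// -hE.
  apply: (le_trans step).
  have -> : (c - e) * (2 * (k%:R * (L * (Y ^+ 3 + Y ^+ 2 + 1)))) =
     (c * (2 * k%:R) - 2 * k%:R * e) * (L * (Y ^+ 3 + Y ^+ 2 + 1)) by ring.
  rewrite cE.
  (* The height of the block, at most Y^3 + Y^2 + 1, exceeds the exponent Y^3 - 2 of the count by
     Y^2 + 3; this loss and the factor k must be paid by the margin e. *)
  have keyN : (k%:R - 1) * (Y ^+ 2 + 3) + `|ln k%:R| / L <=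
    2 * k%:R * e * (Y ^+ 3 + Y ^+ 2 + 1).
    have a1 : D * Y ^+ 2 <= 2 * k%:R * e * Y ^+ 3.
      have -> : 2 * k%:R * e * Y ^+ 3 = Y * (2 * k%:R * e) * Y ^+ 2 by ring.
      by rewrite ler_wpM2r// (le_trans ler01).
    have a2 : `|ln k%:R| / L <= `|ln k%:R| / L * Y ^+ 2.
      by rewrite ler_peMr// divr_ge0// ltW.
    have a3 : 0 <= 2 * k%:R * e * (Y ^+ 2 + 1) by rewrite mulr_ge0 ?ltW//; lra.
    have a4 : (k%:R - 1) * (Y ^+ 2 + 3) <= 4 * k%:R * Y ^+ 2.
      have : (k%:R - 1) * (Y ^+ 2 + 3) <= (k%:R - 1) * (4 * Y ^+ 2).
        by rewrite ler_wpM2l ?subr_ge0//; lra.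
      move=> /le_trans; apply.
      have -> : (k%:R - 1) * (4 * Y ^+ 2) =
        4 * k%:R * Y ^+ 2 - 4 * Y ^+ 2 by ring.
      by rewrite gerBl mulr_ge0// (le_trans ler01).
    rewrite /D mulrDl in a1.
    apply: (@le_trans _ _ (2 * k%:R * e * Y ^+ 3)).
      by rewrite (le_trans _ a1)// lerD.
    by rewrite -addrA [leRHS]mulrDr lerDl.
  have keyL : L * ((k%:R - 1) * (Y ^+ 2 + 3) + `|ln k%:R| / L) <=
              L * (2 * k%:R * e * (Y ^+ 3 + Y ^+ 2 + 1)) by rewrite ler_pM2l.
  have e1 : L * ((k%:R - 1) * (Y ^+ 2 + 3) + `|ln k%:R| / L) =
    (k%:R - 1) * (L * (Y ^+ 2 + 3)) + `|ln k%:R| by field; rewrite gt_eqF.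
  rewrite e1 in keyL.
  have -> : (k%:R - 1 - 2 * k%:R * e) * (L * (Y ^+ 3 + Y ^+ 2 + 1)) =
    (k%:R - 1) * (L * (Y ^+ 3 - 2)) + (k%:R - 1) * (L * (Y ^+ 2 + 3)) -
    L * (2 * k%:R * e * (Y ^+ 3 + Y ^+ 2 + 1)) by ring.
  rewrite lerBlDr; apply: (le_trans (lerD lnrep (lexx _))).
  rewrite -addrA addrCA lerD2l; apply: le_trans keyL.
  by rewrite addrC lerD2l.
Qed.

End ALam.

(** * Complex-valued integration *)

Section Normc.
Variable R : realType.
Implicit Types z w : R[i].

(** The norm on [R[i]] takes its values in [R[i]]; [normc] is the real-valued modulus, the one that
    can be integrated. *)
Lemma normr_normc z : `|z| = (normc z)%:C%C. Proof. by []. Qed.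

Lemma normc_ge0 z : 0 <= normc z.
Proof. by case: z => a b; exact: sqrtr_ge0. Qed.

Lemma normc_sqrE z : normc z ^+ 2 = Re z ^+ 2 + Im z ^+ 2.
Proof. by case: z => a b /=; rewrite sqr_sqrtr// addr_ge0 ?sqr_ge0. Qed.

Lemma Re_le_normc z : `|Re z| <= normc z.
Proof.
rewrite -(ler_pXn2r (_ : 0 < 2)%N) ?nnegrE ?normc_ge0//
  normc_sqrE real_normK ?num_real//.
by rewrite lerDl sqr_ge0.
Qed.

Lemma Im_le_normc z : `|Im z| <= normc z.
Proof.
rewrite -(ler_pXn2r (_ : 0 < 2)%N) ?nnegrE ?normc_ge0//
  normc_sqrE real_normK ?num_real//.
by rewrite lerDr sqr_ge0.
Qed.

Lemma normc_conjc z : normc (conjc z) = normc z.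
Proof. by case: z => a b /=; rewrite sqrrN. Qed.

Lemma normc_real (x : R) : normc x%:C%C = `|x|.
Proof. by rewrite /= expr0n addr0 sqrtr_sqr. Qed.

Lemma normc_sum (I : Type) (r : seq I) (P : pred I) (F : I -> R[i]) :
  normc (\sum_(i <- r | P i) F i) <= \sum_(i <- r | P i) normc (F i).
Proof.
apply: (big_ind2 (fun z (x : R) => normc z <= x)) => //.
  by rewrite Normc.normc0.
by move=> z x w y zx wy; apply: le_trans (le_normcD _ _) (lerD zx wy).
Qed.

Lemma mul_conjc z : z * conjc z = (normc z ^+ 2)%:C%C.
Proof.
by rewrite normc_sqrE; case: z => a b /=; congr Complex; rewrite /=; ring.
Qed.

Lemma cReM z w : Re (z * w) = Re z * Re w - Im z * Im w.
Proof. by case: z => a b; case: w. Qed.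

Lemma cImM z w : Im (z * w) = Re z * Im w + Im z * Re w.
Proof. by case: z => a b; case: w. Qed.

Lemma cReD z w : Re (z + w) = Re z + Re w.
Proof. by case: z => a b; case: w. Qed.

Lemma cImD z w : Im (z + w) = Im z + Im w.
Proof. by case: z => a b; case: w. Qed.

Lemma cReJ z : Re (conjc z) = Re z. Proof. by case: z. Qed.

Lemma cImJ z : Im (conjc z) = - Im z. Proof. by case: z. Qed.

Lemma cRe_sum (I : Type) (r : seq I) (P : pred I) (F : I -> R[i]) :
  Re (\sum_(i <- r | P i) F i) = \sum_(i <- r | P i) Re (F i).
Proof. exact: (big_morph _ cReD). Qed.

Lemma cIm_sum (I : Type) (r : seq I) (P : pred I) (F : I -> R[i]) :
  Im (\sum_(i <- r | P i) F i) = \sum_(i <- r | P i) Im (F i).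
Proof. exact: (big_morph _ cImD). Qed.

End Normc.

Section CInt.
Variables (R : realType) (G : topologicalZmodType)
  (m : probability (borel G) R).
Local Notation T := (borel G).
Implicit Types f g : T -> R[i].

(** Complex functions are handled by components, in accordance with [Lp] and [cintegral]. *)
Definition cmeasurable f :=
  measurable_fun setT (fun x => Re (f x)) /\
  measurable_fun setT (fun x => Im (f x)).

Definition cintegrable f :=
  m.-integrable setT (fun x => (Re (f x))%:E) /\
  m.-integrable setT (fun x => (Im (f x))%:E).

Lemma cmeasurable_cst c : cmeasurable (fun=> c).
Proof. by split; exact: measurable_cst. Qed.

Lemma cmeasurableD f g : cmeasurable f -> cmeasurable g ->
  cmeasurable (fun x => f x + g x).
Proof.
move=> [f1 f2] [g1 g2]; split.
- under eq_fun do rewrite cReD; exact: measurable_funD.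
- under eq_fun do rewrite cImD; exact: measurable_funD.
Qed.

Lemma cmeasurableM f g : cmeasurable f -> cmeasurable g ->
  cmeasurable (fun x => f x * g x).
Proof.
move=> [f1 f2] [g1 g2]; split.
- under eq_fun do rewrite cReM.
  by apply: measurable_funB; exact: measurable_funM.
- under eq_fun do rewrite cImM.
  by apply: measurable_funD; exact: measurable_funM.
Qed.

Lemma cmeasurableJ f : cmeasurable f -> cmeasurable (fun x => conjc (f x)).
Proof.
move=> [f1 f2]; split.
- by under eq_fun do rewrite cReJ.
- under eq_fun do rewrite cImJ; exact: measurable_funN.
Qed.

Lemma cmeasurable_sum (I : Type) (r : seq I) (F : I -> T -> R[i]) :
  (forall i, cmeasurable (F i)) -> cmeasurable (fun x => \sum_(i <- r) F i x).
Proof.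
move=> h; elim: r => [|i r ih].
  by under eq_fun do rewrite big_nil; exact: cmeasurable_cst.
by under eq_fun do rewrite big_cons; exact: cmeasurableD.
Qed.

Lemma measurable_normc f : cmeasurable f ->
  measurable_fun setT (fun x => normc (f x)).
Proof.
move=> [f1 f2].
have -> : (fun x => normc (f x)) =
    (fun x => Num.sqrt (Re (f x) ^+ 2 + Im (f x) ^+ 2)).
  by apply/funext => x; case: (f x).
apply: measurableT_comp;
  first exact: continuous_measurable_fun (@sqrt_continuous R).
by apply: measurable_funD; exact: measurable_funX.
Qed.

Lemma cintegrable_le f (h : T -> R) : cmeasurable f ->
  m.-integrable setT (EFin \o h) -> (forall x, normc (f x) <= h x) ->
  cintegrable f.
Proof.
move=> [f1 f2] ih fh; split.
- apply: le_integrable ih => //; first exact/measurable_EFinP.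
  move=> x _ /=; rewrite lee_fin (le_trans (Re_le_normc _))//.
  by rewrite (le_trans (fh x))// ler_norm.
- apply: le_integrable ih => //; first exact/measurable_EFinP.
  move=> x _ /=; rewrite lee_fin (le_trans (Im_le_normc _))//.
  by rewrite (le_trans (fh x))// ler_norm.
Qed.

Lemma integrable_cst_prob (C : R) : m.-integrable setT (EFin \o (fun=> C)).
Proof. exact: finite_measure_integrable_cst. Qed.

Lemma cintegrable_bounded f C : cmeasurable f -> (forall x, normc (f x) <= C) ->
  cintegrable f.
Proof. by move=> mf fC; apply: (cintegrable_le mf (integrable_cst_prob C)). Qed.

Lemma cintegrableD f g : cintegrable f -> cintegrable g ->
  cintegrable (fun x => f x + g x).
Proof.
move=> [f1 f2] [g1 g2]; split.
- by under eq_fun do rewrite cReD EFinD; exact: integrableD.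
- by under eq_fun do rewrite cImD EFinD; exact: integrableD.
Qed.

Lemma cintegralD f g : cintegrable f -> cintegrable g ->
  cintegral m (fun x => f x + g x) = cintegral m f + cintegral m g.
Proof.
move=> [f1 f2] [g1 g2]; congr Complex.
- by under eq_Rintegral do rewrite cReD; exact: RintegralD.
- by under eq_Rintegral do rewrite cImD; exact: RintegralD.
Qed.

Lemma integrable_mulr (c : R) (h : T -> R) :
  m.-integrable setT (EFin \o h) ->
  m.-integrable setT (EFin \o (fun x => c * h x)).
Proof.
move=> ih; rewrite (_ : EFin \o _ = (fun x => c%:E * (EFin \o h) x)%E)//.
exact: integrableZl.
Qed.

Lemma cintegrableZ c f : cintegrable f -> cintegrable (fun x => c * f x).
Proof.
move=> [f1 f2]; split.
- under eq_fun do rewrite cReM EFinB.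
  by apply: integrableB => //; exact: integrable_mulr.
- under eq_fun do rewrite cImM EFinD.
  by apply: integrableD => //; exact: integrable_mulr.
Qed.

Lemma cintegralZ c f : cintegrable f ->
  cintegral m (fun x => c * f x) = c * cintegral m f.
Proof.
move=> [f1 f2]; case: c => a b; congr Complex => /=.
- under eq_Rintegral do rewrite cReM /=.
  by rewrite RintegralB ?RintegralZl//; exact: integrable_mulr.
- under eq_Rintegral do rewrite cImM /=.
  by rewrite RintegralD ?RintegralZl//; exact: integrable_mulr.
Qed.

Lemma cintegral0 : cintegral m (fun=> 0) = 0.
Proof. by rewrite /cintegral !Rintegral_cst// !mul0r. Qed.

Lemma cintegrable_sum (I : Type) (r : seq I) (F : I -> T -> R[i]) :
  (forall i, cintegrable (F i)) -> cintegrable (fun x => \sum_(i <- r) F i x).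
Proof.
move=> h; elim: r => [|i r ih].
  under eq_fun do rewrite big_nil.
  apply: (@cintegrable_bounded _ 0); first exact: cmeasurable_cst.
  by move=> x; rewrite Normc.normc0.
by under eq_fun do rewrite big_cons; exact: cintegrableD.
Qed.

Lemma cintegral_sum (I : Type) (r : seq I) (F : I -> T -> R[i]) :
  (forall i, cintegrable (F i)) ->
  cintegral m (fun x => \sum_(i <- r) F i x) = \sum_(i <- r) cintegral m (F i).
Proof.
move=> h; elim: r => [|i r ih].
  by under eq_fun do rewrite big_nil; rewrite cintegral0 big_nil.
under eq_fun do rewrite big_cons.
by rewrite cintegralD ?ih ?big_cons//; exact: cintegrable_sum.
Qed.

Lemma measurable_continuous (f : G -> R) : continuous f ->
  measurable_fun (setT : set T) f.
Proof.
move=> /continuousP cf; apply: (measurability _ (RGenOpens.measurableE R)).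
move=> _ [_ [a [b ->] <-]]; rewrite setTI.
by apply: sub_sigma_algebra; apply: cf; exact: interval_open.
Qed.

Lemma continuous_Re_Im (f : G -> R[i]) : continuous (f : G -> R[i]^o) ->
  continuous (fun x => Re (f x)) /\ continuous (fun x => Im (f x)).
Proof.
move=> cf.
have lip (p : R[i] -> R) : (forall z w, p z - p w = p (z - w)) ->
    (forall z, `|p z| <= normc z) -> continuous ((p \o f) : G -> R).
  move=> pB pn x; apply/cvgrPdist_lt => e e0.
  have e0' : 0 < e%:C%C :> R[i] by rewrite ltcR.
  have := cf x => /cvgrPdist_lt/(_ _ e0'); apply: filterS => y /=.
  rewrite normr_normc ltcR pB; exact: le_lt_trans.
split.
- have := lip (@complex.Re R); apply; first by move=> [a b] [c d].
  exact: Re_le_normc.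
- have := lip (@complex.Im R); apply; first by move=> [a b] [c d].
  exact: Im_le_normc.
Qed.

Lemma continuous_cmeasurable (f : G -> R[i]) :
  continuous (f : G -> R[i]^o) -> cmeasurable f.
Proof.
by move=> /continuous_Re_Im[? ?]; split; exact: measurable_continuous.
Qed.

End CInt.

(** * Characters and trigonometric polynomials *)

Section Char.
Variables (R : realType) (G : topologicalZmodType).
Implicit Types chi psi : G -> R[i].

Lemma normc_character chi x : character chi -> normc (chi x) = 1.
Proof. by case=> _ _ /(_ x); rewrite normr_normc => /complexI. Qed.

Lemma character_conjK chi x : character chi -> chi x * conjc (chi x) = 1.
Proof. by move=> h; rewrite mul_conjc normc_character// expr1n. Qed.

Lemma character_cmeasurable chi : character chi -> cmeasurable chi.
Proof. by case=> /continuous_cmeasurable. Qed.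

Lemma expiD (x y : R) : expi (x + y) = expi x * expi y.
Proof.
by rewrite /expi cosD sinD; congr Complex;
  rewrite // addrC [X in X + _]mulrC [X in _ + X]mulrC.
Qed.

Lemma lift_freqM (beta : R -> G) x y chi psi : lift_freq beta x chi ->
  lift_freq beta y psi -> forall t, chi (beta t) * psi (beta t) =
    expi (- ((x + y) * t)).
Proof.
by move=> [_ h1] [_ h2] t; rewrite h1 h2 -expiD mulrDl opprD.
Qed.

Lemma dense_eq (D : set G) (f g : G -> R) : dense D -> continuous f ->
  continuous g -> {in D, f =1 g} -> f =1 g.
Proof.
move=> dD cf cg fg x; apply: contrapT => /eqP fgx.
have oU : open [set y | f y - g y != 0].
  have : continuous (fun y => f y - g y) by move=> y; apply: cvgB;
    [exact: cf|exact: cg].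
  by move=> /continuousP/(_ [set z | z != 0]); apply; exact: open_neq.
have [|y [/= Uy Dy]] := dD [set y | f y - g y != 0] _ oU.
  by exists x; rewrite /= subr_eq0.
by move: Uy; rewrite fg ?inE// subrr eqxx.
Qed.

Lemma dense_eqc (D : set G) (f g : G -> R[i]) : dense D ->
  continuous (f : G -> R[i]^o) -> continuous (g : G -> R[i]^o) ->
  (forall x, D x -> f x = g x) -> forall x, f x = g x.
Proof.
move=> dD /continuous_Re_Im[f1 f2] /continuous_Re_Im[g1 g2] fg x.
have := dense_eq dD f1 g1; have := dense_eq dD f2 g2.
have h1 : {in D, (fun x => Im (f x)) =1 (fun x => Im (g x))}.
  by move=> y; rewrite inE => /fg ->.
have h2 : {in D, (fun x => Re (f x)) =1 (fun x => Re (g x))}.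
  by move=> y; rewrite inE => /fg ->.
move=> /(_ h1 x) /= e1 /(_ h2 x) /= e2.
by move: e1 e2; case: (f x) => a b; case: (g x) => c d /= -> ->.
Qed.

Lemma continuousMc (f g : G -> R[i]) : continuous (f : G -> R[i]^o) ->
  continuous (g : G -> R[i]^o) ->
    continuous ((fun x => f x * g x) : G -> R[i]^o).
Proof. by move=> cf cg x; apply: cvgM; [exact: cf|exact: cg]. Qed.

Lemma lift_freq_uniq (beta : R -> G) x chi psi : dense (range beta) ->
  lift_freq beta x chi -> lift_freq beta x psi -> chi = psi.
Proof.
move=> db [[c1 _ _] h1] [[c2 _ _] h2]; apply/funext.
by apply: (dense_eqc db c1 c2) => _ [t _ <-]; rewrite h1 h2.
Qed.

Lemma lift_freq_inj (beta : R -> G) x y chi : lift_freq beta x chi ->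
  lift_freq beta y chi -> x = y.
Proof.
move=> [_ h1] [_ h2]; apply: contrapT => /eqP; rewrite -subr_eq0 => xy.
(* At t = pi / (x - y) the two exponentials would be opposite, whereas both equal [chi (beta t)]. *)
have := h1 (pi / (x - y)); rewrite h2 => -[hc hs].
have : cos (- (x * (pi / (x - y))) - - (y * (pi / (x - y)))) = 1.
  by rewrite cosB hc hs -!expr2 cos2Dsin2.
have -> : - (x * (pi / (x - y))) - - (y * (pi / (x - y))) = - pi.
  by field.
rewrite cosN cospi => /eqP; rewrite eq_sym -subr_eq0 opprK.
by rewrite (_ : 1 + 1 = 2%:R)// pnatr_eq0.
Qed.

Lemma continuousJ (f : G -> R[i]) : continuous (f : G -> R[i]^o) ->
  continuous ((fun x => conjc (f x)) : G -> R[i]^o).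
Proof.
move=> cf x; apply/cvgrPdist_lt => e e0.
have := cf x => /cvgrPdist_lt/(_ _ e0); apply: filterS => y /=.
have -> : conjc (f x) - conjc (f y) = conjc (f x - f y) by rewrite rmorphB.
by rewrite !normr_normc normc_conjc.
Qed.

Lemma characterMJ chi psi : character chi -> character psi ->
  character (fun x => chi x * conjc (psi x)).
Proof.
move=> hc hp; split; first by apply: continuousMc;
  [case: hc|apply: continuousJ; case: hp].
- case: hc hp => _ h1 _ [_ h2 _] x y; rewrite h1 h2 rmorphM/=.
  by rewrite mulrACA.
- by move=> x; rewrite normr_normc Normc.normcM normc_conjc !normc_character//
  mulr1.
Qed.

End Char.

(** * Invariance of the measure and orthogonality of characters *)

Section Haar.
Variables (R : realType) (G : topologicalZmodType)
  (m : probability (borel G) R).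
Local Notation T := (borel G).
Implicit Types (chi psi : G -> R[i]) (f g : T -> R[i]).

Hypothesis minv : forall (x : G) (B : set T), measurable B ->
  m ((fun y : G => x + y) @^-1` B) = m B.

Let shift (x : G) : T -> T := fun y : G => x + y.

Lemma measurable_shift x : measurable_fun setT (shift x).
Proof.
apply: (@measurability _ _ T T setT (shift x) (@open G) erefl) => _ [B oB <-];
  rewrite setTI.
apply: sub_sigma_algebra.
have : continuous ((fun y : G => x + y) : G -> G).
  move=> y.
  apply: (@continuous_comp _ _ _ (fun y : G => (x, y))
    (fun z : G * G => z.1 + z.2)).
    by apply: cvg_pair; [exact: cvg_cst|exact: cvg_id].
  exact: tvs.add_continuous.
by move=> /continuousP; apply.
Qed.

(** Invariance says that the push-forward of [m] under the shift is [m]; the equality is then the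
    change of variables formula. *)
Lemma Rintegral_shift x (h : T -> R) : measurable_fun setT h ->
  m.-integrable setT (EFin \o (h \o shift x)) ->
  \int[m]_y h (shift x y) = \int[m]_y h y.
Proof.
move=> mh ih; rewrite /Rintegral; congr fine.
have mE : measurable_fun setT (EFin \o h) by exact/measurable_EFinP.
have := @integral_pushforward _ _ _ _ R (shift x)
  (measurable_shift x) m setT (EFin \o h) mE.
move=> /(_ ih measurableT) <-.
apply: eq_measure_integral => [|mS A mA _];
  [exact: measurable_shift|exact: minv].
Qed.

Lemma cintegral_shift x f C : cmeasurable f -> (forall y, normc (f y) <= C) ->
  cintegral m (f \o shift x) = cintegral m f.
Proof.
move=> [f1 f2] fC.
have mf : cmeasurable (f \o shift x).
  by split; [apply: (measurableT_comp f1)|apply: (measurableT_comp f2)];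
    exact: measurable_shift.
have [i1 i2] : cintegrable m (f \o shift x).
  by apply: (@cintegrable_bounded _ _ _ _ C) => // y; exact: fC.
by congr Complex; exact: Rintegral_shift.
Qed.

(** Translating by x multiplies the integral by [chi x] and leaves it unchanged; it vanishes as soon
    as some [chi x] differs from 1. *)
Lemma cintegral_character chi : character chi -> chi <> (fun=> 1) ->
  cintegral m chi = 0.
Proof.
move=> hc c1.
have [x cx] : exists x, chi x <> 1.
  by apply: contrapT => /forallNP h; apply: c1; apply/funext => x;
    exact: contrapT.
have mc := character_cmeasurable hc.
have bc y : normc (chi y) <= 1 by rewrite normc_character.
have := cintegral_shift x mc bc.
have -> : chi \o shift x = (fun y => chi x * chi y).
  by apply/funext => y /=; case: hc => _ -> _.
rewrite cintegralZ; last exact: cintegrable_bounded mc bc.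
move=> /eqP; rewrite -subr_eq0 -{2}[cintegral m chi]mul1r -mulrBl mulf_eq0.
by rewrite subr_eq0 => /orP[/eqP//|/eqP].
Qed.

Lemma fourier_self chi : character chi -> fourier m chi chi = 1.
Proof.
move=> hc; rewrite /fourier; under eq_fun do rewrite character_conjK//.
by rewrite /cintegral !Rintegral_cst//= probability_setT /= mulr1 mul0r.
Qed.

Lemma fourier_distinct chi psi : character chi -> character psi -> chi <> psi ->
  fourier m chi psi = 0.
Proof.
move=> hc hp ne; apply: cintegral_character (characterMJ hc hp) _ => e;
  apply: ne.
apply/funext => x; have := congr1 (fun h : G -> R[i] => h x * psi x) e.
by rewrite -mulrA [conjc _ * _]mulrC character_conjK// mulr1 mul1r.
Qed.

End Haar.

(** Cauchy-Schwarz against the constant 1, from the squares of the deviations of the a_i from their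
    mean. *)
Lemma sqr_sum_le (R : realFieldType) (I : Type) (s : seq I) (a : I -> R) :
  (\sum_(i <- s) a i) ^+ 2 <= (size s)%:R * \sum_(i <- s) a i ^+ 2.
Proof.
case: s => [|i s]; first by rewrite !big_nil expr0n mulr0.
set A := \sum_(_ <- _) a _; set S := \sum_(_ <- _) _ ^+ 2.
set n : R := (size _)%:R; have n0 : 0 < n by rewrite ltr0n.
have : \sum_(j <- i :: s) (2 * (A / n) * a j) <=
  \sum_(j <- i :: s) ((A / n) ^+ 2 + a j ^+ 2).
  by apply: ler_sum => j _; have := sqr_ge0 (A / n - a j); nra.
rewrite -mulr_sumr -/A big_split /=
  -/S big_const_seq count_predT iter_addr addr0.
rewrite -[_ *+ _]mulr_natl -/n => h.
rewrite -ler_pdivrMl// mulrC.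
suff : 2 * (A / n) * A - n * (A / n) ^+ 2 = A ^+ 2 / n by lra.
by field; rewrite gt_eqF.
Qed.

(** * Parseval, Bessel and Nikolskii inequalities for trigonometric polynomials *)

Section Poly.
Variables (R : realType) (G : topologicalZmodType)
  (m : probability (borel G) R).
Local Notation T := (borel G).
Implicit Types (chi psi : G -> R[i]) (f g : T -> R[i]).

Hypothesis minv : forall (x : G) (B : set T), measurable B ->
  m ((fun y : G => x + y) @^-1` B) = m B.

Variable h : nat -> G -> R[i].
Hypothesis hchar : forall n, character (h n).
Hypothesis hinj : injective h.

(** An index repeated in [s] counts with multiplicity; the Fejer kernel is later written as such a
    list, its triangular coefficients being multiplicities. *)
Definition trig (s : seq nat) (c : nat -> R[i]) : T -> R[i] :=
  fun x => \sum_(n <- s) c n * h n x.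

Lemma trig_cmeasurable s c : cmeasurable (trig s c).
Proof.
apply: cmeasurable_sum => n; apply: cmeasurableM; first exact: cmeasurable_cst.
exact: character_cmeasurable.
Qed.

Lemma trig_le s c x : normc (trig s c x) <= \sum_(n <- s) normc (c n).
Proof.
rewrite (le_trans (normc_sum _ _ _))// ler_sum// => n _.
by rewrite Normc.normcM (normc_character x (hchar n)) mulr1.
Qed.

Lemma cintegrable_MJ f chi : cintegrable m f -> cmeasurable f ->
  character chi ->
  cintegrable m (fun x => f x * conjc (chi x)).
Proof.
move=> fi mf hc.
apply: (@cintegrable_le _ _ _ _ (fun x => `|Re (f x)| + `|Im (f x)|)).
- by apply: cmeasurableM => //; apply: cmeasurableJ;
  exact: character_cmeasurable.
- case: fi => f1 f2.
  rewrite (_ : EFin \o _ = (fun x => `|(Re (f x))%:E| + `|(Im (f x))%:E|)%E)//.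
  by apply: integrableD => //; exact: integrable_abse.
- move=> x; rewrite Normc.normcM normc_conjc (normc_character x hc) mulr1.
  case: (f x) => a b.
  rewrite -(ler_pXn2r (_ : 0 < 2)%N) ?nnegrE ?normc_ge0 ?addr_ge0//.
  rewrite normc_sqrE /= sqrrD !real_normK ?num_real// -addrA lerD2l lerDr.
  by rewrite mulrn_wge0// mulr_ge0.
Qed.

Lemma fourier_trig s c chi : character chi ->
  fourier m (trig s c) chi = \sum_(n <- s) c n * fourier m (h n) chi.
Proof.
move=> hc; rewrite /fourier /trig.
have ic n : cintegrable m (fun x : T => h n x * conjc (chi x)).
  apply: (@cintegrable_bounded _ _ _ _ 1).
    exact: character_cmeasurable (characterMJ _ _).
  by move=> x; rewrite (normc_character x (characterMJ (hchar n) hc)).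
transitivity (cintegral m
  (fun x => \sum_(n <- s) c n * (h n x * conjc (chi x)))).
  congr cintegral; apply/funext => x; rewrite mulr_suml.
  by apply: eq_bigr => n _; rewrite mulrA.
rewrite cintegral_sum; last by move=> n; exact: cintegrableZ.
by apply: eq_bigr => n _; rewrite cintegralZ.
Qed.

Lemma fourier_trig_in s c l : uniq s ->
  fourier m (trig s c) (h l) = if l \in s then c l else 0.
Proof.
move=> us; rewrite fourier_trig//.
have h0 n : n != l -> fourier m (h n) (h l) = 0.
  by move=> nl; apply: fourier_distinct => // /hinj /eqP; rewrite (negbTE nl).
case: ifPn => ls.
  rewrite (bigD1_seq l)//= fourier_self// mulr1 big1 ?addr0// => n nl.
  by rewrite h0// mulr0.
rewrite big_seq big1// => n ns; rewrite h0 ?mulr0//.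
by apply: contraNneq ls => <-.
Qed.

Lemma fourier_trig_out s c chi : character chi -> (forall n, h n <> chi) ->
  fourier m (trig s c) chi = 0.
Proof.
move=> hc hn; rewrite fourier_trig// big1// => n _.
by rewrite fourier_distinct ?mulr0.
Qed.

Lemma cintegral_trigJ f s c : cintegrable m f -> cmeasurable f ->
  cintegral m (fun x => f x * conjc (trig s c x)) =
  \sum_(n <- s) conjc (c n) * fourier m f (h n).
Proof.
move=> fi mf.
transitivity (cintegral m
  (fun x => \sum_(n <- s) conjc (c n) * (f x * conjc (h n x)))).
  congr cintegral; apply/funext => x; rewrite rmorph_sum mulr_sumr.
  by apply: eq_bigr => n _; rewrite rmorphM/= mulrCA.
rewrite cintegral_sum; last by move=> n; apply: cintegrableZ;
  exact: cintegrable_MJ.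
by apply: eq_bigr => n _; rewrite cintegralZ//; exact: cintegrable_MJ.
Qed.

Lemma cintegrable_MJ_trig f s c : cintegrable m f -> cmeasurable f ->
  cintegrable m (fun x => f x * conjc (trig s c x)).
Proof.
move=> fi mf.
rewrite (_ : (fun x => _) =
  (fun x => \sum_(n <- s) conjc (c n) * (f x * conjc (h n x)))).
  by apply: cintegrable_sum => n; apply: cintegrableZ; exact: cintegrable_MJ.
apply/funext => x; rewrite rmorph_sum mulr_sumr.
by apply: eq_bigr => n _; rewrite rmorphM/= mulrCA.
Qed.

Lemma trig_cintegrable s c : cintegrable m (trig s c).
Proof. exact: cintegrable_bounded (trig_cmeasurable _ _) (trig_le s c). Qed.

Lemma trig_integrableX s c n :
  m.-integrable setT (EFin \o (fun x => normc (trig s c x) ^+ n)).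
Proof.
have ih := integrable_cst_prob m ((\sum_(l <- s) normc (c l)) ^+ n).
apply: le_integrable ih => //.
  apply/measurable_EFinP; apply: measurable_funX; apply: measurable_normc.
  exact: trig_cmeasurable.
move=> x _ /=; rewrite lee_fin !normrX lerXn2r ?nnegrE//.
rewrite ger0_norm ?normc_ge0// ger0_norm ?trig_le//.
by apply: sumr_ge0 => l _; exact: normc_ge0.
Qed.

Lemma parseval s c : uniq s ->
  \int[m]_x normc (trig s c x) ^+ 2 = \sum_(n <- s) normc (c n) ^+ 2.
Proof.
move=> us.
have := cintegral_trigJ s c (trig_cintegrable s c) (trig_cmeasurable s c).
move=> /(congr1 (@complex.Re R)) /=.
under eq_Rintegral do rewrite mul_conjc.
move=> ->; rewrite cRe_sum; apply: eq_big_seq => n ns.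
by rewrite fourier_trig_in// ns mulrC mul_conjc.
Qed.

(** With P the polynomial whose coefficients are those of f, integrate the pointwise inequality 2
    Re(f conj(P)) - |P|^2 <= |f|^2: both terms on the left are given by the sum of squares. *)
Lemma bessel f s : uniq s -> cintegrable m f -> cmeasurable f ->
  m.-integrable setT (EFin \o (fun x => normc (f x) ^+ 2)) ->
  \sum_(n <- s) normc (fourier m f (h n)) ^+ 2 <= \int[m]_x normc (f x) ^+ 2.
Proof.
move=> us fi mf f2; set c := fun n => fourier m f (h n).
have mP := trig_cmeasurable s c.
have fPi := cintegrable_MJ_trig s c fi mf.
have := cintegral_trigJ s c fi mf => /(congr1 (@complex.Re R)).
rewrite cRe_sum /=.
have -> : \sum_(n <- s) Re (conjc (c n) * fourier m f (h n)) =
    \sum_(n <- s) normc (c n) ^+ 2.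
  by apply: eq_bigr => n _; rewrite mulrC mul_conjc.
move=> e; have pe := parseval c us.
have : \int[m]_x (2 * Re (f x * conjc (trig s c x)) - normc (trig s c x) ^+ 2)
  <= \int[m]_x normc (f x) ^+ 2.
  apply: le_Rintegral => //.
    have i1 : m.-integrable setT
        (EFin \o (fun x => 2 * Re (f x * conjc (trig s c x)))).
      by apply: integrable_mulr; case: fPi.
    exact: (integrableB measurableT i1 (trig_integrableX s c 2)).
  move=> x _; rewrite cReM cReJ cImJ !normc_sqrE.
  set a := Re (f x); set b := Im (f x); set a' := Re _; set b' := Im _.
  by have := sqr_ge0 (a - a'); have := sqr_ge0 (b - b'); nra.
rewrite RintegralB//; last 2 first.
- by apply: integrable_mulr; case: fPi.
- exact: trig_integrableX.
rewrite RintegralZl//; last by case: fPi.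
by rewrite e pe; lra.
Qed.

(** By Cauchy-Schwarz |P|^2 is at most N S pointwise, S being the sum of the squared coefficients.
    Hence |P|^(2k) <= (N S)^(k-1) |P|^2, and Parseval integrates the last factor. *)
Lemma nikolskii s c k : uniq s -> (0 < k)%N ->
  \int[m]_x normc (trig s c x) ^+ (2 * k) <=
  (size s)%:R ^+ k.-1 * (\sum_(n <- s) normc (c n) ^+ 2) ^+ k.
Proof.
move=> us k0; set S := \sum_(n <- s) _.
have S0 : 0 <= S by apply: sumr_ge0 => n _; exact: sqr_ge0.
have -> : (size s)%:R ^+ k.-1 * S ^+ k = ((size s)%:R * S) ^+ k.-1 * S.
  by rewrite exprMn -mulrA -exprSr prednK.
rewrite [X in _ <= _ * X](_ : S = \int[m]_x normc (trig s c x) ^+ 2);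
  last by rewrite parseval.
rewrite -RintegralZl//; last exact: trig_integrableX.
apply: le_Rintegral => //; first exact: trig_integrableX.
  by apply: integrable_mulr; exact: trig_integrableX.
move=> x _; rewrite exprM -[in leLHS](prednK k0) exprSr ler_wpM2r ?sqr_ge0//.
rewrite lerXn2r ?nnegrE ?sqr_ge0 ?mulr_ge0//.
apply: le_trans (sqr_sum_le s (fun n => normc (c n))).
rewrite ler_pXn2r ?nnegrE ?normc_ge0 ?trig_le//.
by apply: sumr_ge0 => n _; exact: normc_ge0.
Qed.

End Poly.

(** * Integrability with integer exponents *)

Section LpNat.
Variables (R : realType) (G : topologicalZmodType)
  (m : probability (borel G) R).
Local Notation T := (borel G).

(** Trades the real powers inside [Lnorm] for an integer power of the modulus, the form used in all
    estimates. *)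
Lemma LpP (n : nat) (f : T -> R[i]) : (0 < n)%N ->
  Lp m (n%:R)%:E f <-> cmeasurable f /\
    m.-integrable setT (EFin \o (fun x => normc (f x) ^+ n)).
Proof.
move=> n0; have nn : n%:R != 0 :> R by rewrite pnatr_eq0 -lt0n.
have E (x : T) : (`|(normc (f x))%:E| `^ n%:R = (normc (f x) ^+ n)%:E)%E.
  by rewrite /= ger0_norm ?normc_ge0// powR_mulrn ?normc_ge0.
have E2 : ((\int[m]_x `|(normc (f x))%:E| `^ n%:R) =
  \int[m]_x `|(normc (f x) ^+ n)%:E|)%E.
  apply: eq_integral => x _; rewrite E gee0_abs// lee_fin exprn_ge0//.
  exact: normc_ge0.
split=> [[m1 m2 fin]|[[m1 m2] /integrableP[_ fin]]].
- split=> //; apply/integrableP; split.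
    apply/measurable_EFinP; apply: measurable_funX.
    by apply: measurable_normc.
  rewrite -E2 ltey; apply/eqP => ey; move: fin; rewrite unlock ey.
  by rewrite poweRyr ?invr_eq0// ltxx.
- split=> //; rewrite unlock E2 poweR_lty//.
Qed.

(** On a probability space y <= 1 + y^n is an integrable bound, so the Fourier coefficients of an
    L_n function are meaningful. *)
Lemma cintegrable_Lp (n : nat) (f : T -> R[i]) : (0 < n)%N -> cmeasurable f ->
  m.-integrable setT (EFin \o (fun x => normc (f x) ^+ n)) -> cintegrable m f.
Proof.
move=> n0 mf fn.
apply: (@cintegrable_le _ _ _ _ (fun x => 1 + normc (f x) ^+ n)) => //.
  exact: (integrableD measurableT (integrable_cst_prob m 1) fn).
move=> x; have := normc_ge0 (f x); set y := normc (f x) => y0.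
have [y1|y1] := leP y 1; first by rewrite (le_trans y1)// lerDl exprn_ge0.
by rewrite (@le_trans _ _ (y ^+ n))// ?lerDr// ler_eXnr// ltW.
Qed.

End LpNat.

(** * Series converging in L_p *)

(** Each N_j is at most r / 2^j, where r is the p-th root of s. Applied pointwise with geometric
    weights, this takes the place of Minkowski's inequality and of the completeness of L_p. *)
Lemma sum_le_of_powers (R : realType) (N : nat -> R) (p : nat) (s : R) :
  (0 < p)%N -> (forall j, 0 <= N j) ->
    (forall j, ((2 ^ j)%:R * N j) ^+ p <= s) ->
  exists r, [/\ 0 <= r, r ^+ p = s & forall J, \sum_(0 <= j < J) N j <= 2 * r].
Proof.
move=> p0 N0 Ns.
have s0 : 0 <= s by apply: le_trans (Ns 0%N); rewrite exprn_ge0// mulr_ge0.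
have rE : (s `^ (p%:R^-1)) ^+ p = s.
  rewrite -powR_mulrn ?powR_ge0// -powRrM mulVf ?powRr1//.
  by rewrite pnatr_eq0 -lt0n.
exists (s `^ (p%:R^-1)); split=> // [|J]; first exact: powR_ge0.
set r := _ `^ _ in rE *; have r0 : 0 <= r by exact: powR_ge0.
have Nr j : N j <= 2 * r * (2 ^ j.+1)%:R^-1.
  rewrite expnS natrM invfM mulrACA divff//
    mul1r ler_pdivlMr ?ltr0n ?expn_gt0//.
  rewrite mulrC -(ler_pXn2r p0) ?nnegrE ?mulr_ge0// rE.
  exact: Ns.
apply: (@le_trans _ _ (\sum_(0 <= j < J) 2 * r * (2 ^ j.+1)%:R^-1)).
  by apply: ler_sum => j _; exact: Nr.
rewrite -mulr_sumr sum_geo2 ler_piMr ?mulr_ge0//.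
Qed.

Section SumLp.
Variables (R : realType) (G : topologicalZmodType)
  (m : probability (borel G) R).
Local Notation T := (borel G).

Lemma Rdominated_cvg (F : nat -> T -> R) (f : T -> R) (g : T -> \bar R) :
  (forall n, measurable_fun setT (F n)) -> measurable_fun setT f ->
  {ae m, forall x, F n x @[n --> \oo] --> f x} -> m.-integrable setT g ->
  (forall n x, (`|F n x|%:E <= g x)%E) ->
  \int[m]_x F n x @[n --> \oo] --> \int[m]_x f x.
Proof.
move=> mF mf Ff ig Fg.
have [|||||fi _ h] := @dominated_convergence _ _ _ m setT measurableT
    (fun n => EFin \o F n) (EFin \o f) g.
- by move=> n; exact/measurable_EFinP.
- exact/measurable_EFinP.
- by apply: filterS Ff => x h _; apply: cvg_EFin => //; exact: nearW.
- exact: ig.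
- by apply: aeW => x n _; exact: Fg.
- apply: fine_cvg; rewrite /Rintegral fineK//.
  exact: integrable_fin_num.
Qed.

Variables (Q : nat -> T -> R[i]) (p : nat) (C : R).
Hypothesis p0 : (0 < p)%N.
Hypothesis mQ : forall j, cmeasurable (Q j).
Hypothesis QC : forall j,
  (\int[m]_x ((((2 ^ j)%:R * normc (Q j x)) ^+ p)%:E) <=
    (C / (2 ^ j.+1)%:R)%:E)%E.
Hypothesis C0 : 0 <= C.

(* If [S x] is finite, then the series of the [normc (Q j x)] is at most twice
   the p-th root of [S x]: integrability of [S] yields both convergence almost
   everywhere and a dominating function. *)
Let S (x : T) : \bar R :=
  (\sum_(0 <= j <oo) (((2 ^ j)%:R * normc (Q j x)) ^+ p)%:E)%E.

Let Sterm_ge0 j x : (0 <= (((2 ^ j)%:R * normc (Q j x)) ^+ p)%:E)%E.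
Proof. by rewrite lee_fin exprn_ge0// mulr_ge0// normc_ge0. Qed.

Let S_ge0 x : (0 <= S x)%E.
Proof. by apply: nneseries_ge0. Qed.

Let mSterm j : measurable_fun setT
  (fun x => (((2 ^ j)%:R * normc (Q j x)) ^+ p)%:E).
Proof.
apply/measurable_EFinP; apply: measurable_funX; apply: measurable_funM => //.
exact: measurable_normc.
Qed.

Let mS : measurable_fun setT S.
Proof. by apply: ge0_emeasurable_sum => // j x _ _; exact: Sterm_ge0. Qed.

Let S_integrable : m.-integrable setT S.
Proof.
apply/integrableP; split=> //.
under eq_integral do rewrite gee0_abs//.
rewrite /S integral_nneseries//.
apply: (@le_lt_trans _ _ C%:E); last exact: ltry.
apply: lime_le.
  by apply: is_cvg_nneseries => j _ _; apply: integral_ge0.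
apply: nearW => J.
apply: (@le_trans _ _ (\sum_(0 <= j < J) (C / (2 ^ j.+1)%:R)%:E)%E).
  by apply: lee_sum => j _; exact: QC.
rewrite sumEFin lee_fin -mulr_sumr sum_geo2 ler_piMr//.
Qed.

Let good x : (S x < +oo)%E -> exists r, [/\ 0 <= r, (r ^+ p)%:E = S x &
  forall J, \sum_(0 <= j < J) normc (Q j x) <= 2 * r].
Proof.
move=> Sx; have Sfin : S x \is a fin_num by rewrite ge0_fin_numE.
have [||r [r0 rE rJ]] :=
  @sum_le_of_powers R (fun j => normc (Q j x)) p (fine (S x)) p0.
- by move=> j; exact: normc_ge0.
- move=> j; rewrite -lee_fin fineK//.
  have := @nneseries_lim_ge R (fun j => (((2 ^ j)%:R * normc (Q j x)) ^+ p)%:E)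
    xpredT 0 j.+1.
  move=> /(_ (fun n _ _ => Sterm_ge0 n x)); apply: le_trans.
  rewrite big_nat_recr//= leeDr// sume_ge0// => i _; exact: Sterm_ge0.
- by exists r; split=> //; rewrite rE fineK.
Qed.

Let P J (x : T) := \sum_(0 <= j < J) Q j x.

Let mP J : cmeasurable (P J).
Proof. exact: cmeasurable_sum. Qed.

Let P_le x r J : (forall J, \sum_(0 <= j < J) normc (Q j x) <= 2 * r) ->
  normc (P J x) <= 2 * r.
Proof. by move=> h; apply: le_trans (normc_sum _ _ _) (h J). Qed.

(** Multiplying the partial sums by this indicator makes them converge at every point, to 0 where
    [S] is infinite, so that the limit is a measurable function. *)
Let e (x : T) : R := \1_[set x | (S x < +oo)%E] x.

Let me : measurable_fun setT e.
Proof.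
apply: measurable_indic; rewrite -[X in measurable X]setTI.
exact: measurable_lte.
Qed.

Let eP x : (S x < +oo)%E -> e x = 1.
Proof. by move=> h; rewrite /e indicE mem_set. Qed.

Let eN x : ~ (S x < +oo)%E -> e x = 0.
Proof. by move=> h; rewrite /e indicE memNset. Qed.

Let is_cvgP (q : R[i] -> R) x : (forall z, `|q z| <= normc z) ->
  (forall J, q (P J x) = \sum_(0 <= j < J) q (Q j x)) ->
  cvgn (fun J => e x * q (P J x)).
Proof.
move=> qn qP; have [Sx|Sx] := pselect (S x < +oo)%E; last first.
  by under eq_fun do rewrite eN// mul0r; exact: is_cvg_cst.
under eq_fun do rewrite eP// mul1r qP.
have [r [r0 _ rJ]] := good Sx.
have : cvgn [normed series (fun j => q (Q j x))].
  apply: nondecreasing_is_cvgn.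
    by apply: nondecreasing_series => j _ _; exact: normr_ge0.
  exists (2 * r) => _ [J _ <-]; apply: le_trans (rJ J).
  by apply: ler_sum => j _; exact: qn.
exact: normed_cvg.
Qed.

Let f (x : T) : R[i] := Complex (lim ((e x * Re (P J x)) @[J --> \oo]))
                               (lim ((e x * Im (P J x)) @[J --> \oo])).

Let cvgRe x : e x * Re (P J x) @[J --> \oo] --> Re (f x).
Proof.
apply: is_cvgP; first exact: Re_le_normc.
by move=> J; rewrite /P cRe_sum.
Qed.

Let cvgIm x : e x * Im (P J x) @[J --> \oo] --> Im (f x).
Proof.
apply: is_cvgP; first exact: Im_le_normc.
by move=> J; rewrite /P cIm_sum.
Qed.

Let mf : cmeasurable f.
Proof.
split.
- apply: (measurable_fun_cvg (h := fun J x => e x * Re (P J x))) => [J|x _].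
    by apply: measurable_funM => //; case: (mP J).
  exact: cvgRe.
- apply: (measurable_fun_cvg (h := fun J x => e x * Im (P J x))) => [J|x _].
    by apply: measurable_funM => //; case: (mP J).
  exact: cvgIm.
Qed.

Let f_le x r : (S x < +oo)%E ->
  (forall J, \sum_(0 <= j < J) normc (Q j x) <= 2 * r) ->
  normc (f x) <= 4 * r.
Proof.
move=> Sx rJ.
have bd (q : R[i] -> R) l : (forall z, `|q z| <= normc z) ->
    e x * q (P J x) @[J --> \oo] --> l -> `|l| <= 2 * r.
  move=> qn /cvg_norm h; rewrite -(cvg_lim _ h)//.
  apply: limr_le; first by apply/cvg_ex; exists `|l|.
  apply: nearW => J; rewrite eP// mul1r (le_trans (qn _))//.
  exact: P_le.
have := bd _ _ (@Re_le_normc R) (@cvgRe x).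
have := bd _ _ (@Im_le_normc R) (@cvgIm x).
move: (f x) => z h1 h2.
have : normc z <= `|Re z| + `|Im z|.
  rewrite -(ler_pXn2r (_ : 0 < 2)%N) ?nnegrE ?normc_ge0 ?addr_ge0//.
  rewrite normc_sqrE sqrrD !real_normK ?num_real// -addrA lerD2l lerDr.
  by rewrite mulrn_wge0// mulr_ge0.
by lra.
Qed.

Let f_integrable : m.-integrable setT (EFin \o (fun x => normc (f x) ^+ p)).
Proof.
have iS : m.-integrable setT (fun x => ((4 ^+ p)%:E * S x)%E) by
  exact: integrableZl.
apply: le_integrable iS => //.
  by apply/measurable_EFinP; apply: measurable_funX; exact: measurable_normc.
move=> x _; rewrite abseM [X in (_ <= _ * X)%E]gee0_abs//.
have [Sx|Sx] := pselect (S x < +oo)%E.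
  have [r [r0 <- rJ]] := good Sx.
  rewrite /= -EFinM lee_fin !normrX -exprMn lerXn2r ?nnegrE ?mulr_ge0//.
  by rewrite !ger0_norm ?normc_ge0//; exact: f_le.
move: Sx => /negP; rewrite -leNgt leye_eq => /eqP ->.
by rewrite mulry gtr0_sg ?mul1e ?leey// normr_gt0 gt_eqF// exprn_gt0.
Qed.

(** The limit is in L_p because |f|^p <= 4^p S. Convergence of the Fourier coefficients is dominated
    convergence, applied to real and imaginary parts separately. *)
Lemma series_Lp : exists f : T -> R[i], [/\ cmeasurable f,
  m.-integrable setT (EFin \o (fun x => normc (f x) ^+ p)) &
  forall chi, character chi ->
    Re (fourier m (fun x => \sum_(0 <= j < J) Q j x) chi) @[J --> \oo] -->
      Re (fourier m f chi) /\
    Im (fourier m (fun x => \sum_(0 <= j < J) Q j x) chi) @[J --> \oo] -->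
      Im (fourier m f chi)].
Proof.
exists f; split=> // chi hc.
have mc : cmeasurable (fun x : T => conjc (chi x)).
  by apply: cmeasurableJ; exact: character_cmeasurable.
(* Partial sums are at most 2 r with r^p = S, and r <= 1 + r^p. *)
have ig : m.-integrable setT (fun x => (2%:E * (1 + S x))%E).
  apply: integrableZl => //; apply: integrableD => //.
  exact: (integrable_cst_prob m 1).
have gP n x : ((normc (P n x * conjc (chi x)))%:E <= 2%:E * (1 + S x))%E.
  rewrite Normc.normcM normc_conjc (normc_character x hc) mulr1.
  have [Sx|Sx] := pselect (S x < +oo)%E.
    have [r [r0 <- rJ]] := good Sx.
    rewrite -EFinD -EFinM lee_fin (le_trans (P_le n rJ))// ler_pM2l//.
    have [r1|r1] := leP r 1; first by rewrite (le_trans r1)// lerDl exprn_ge0.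
    by rewrite (@le_trans _ _ (r ^+ p))// ?lerDr// ler_eXnr// ltW.
  move: Sx => /negP; rewrite -leNgt leye_eq => /eqP ->.
  by rewrite addey// mulry gtr0_sg ?mul1e ?leey.
have cvgP x : (S x < +oo)%E -> Re (P J x) @[J --> \oo] --> Re (f x) /\
    Im (P J x) @[J --> \oo] --> Im (f x).
  move=> Sx; have := @cvgRe x; have := @cvgIm x; rewrite eP//.
  by under eq_fun do rewrite mul1r; move=> h1; under eq_fun do rewrite mul1r.
have aeS : {ae m, forall x, (S x < +oo)%E}.
  have := integrable_ae measurableT S_integrable.
  by apply: filterS => x /(_ I); rewrite ge0_fin_numE.
split.
- apply: (Rdominated_cvg (F := fun J x => Re (P J x * conjc (chi x))) _ _ _ ig).
  + by move=> J; case: (cmeasurableM (mP J) mc).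
  + by case: (cmeasurableM mf mc).
  + apply: filterS aeS => x /cvgP[h1 h2]; rewrite cReM.
    under eq_fun do rewrite cReM.
    by apply: cvgB; apply: cvgM => //; exact: cvg_cst.
  + move=> n x; apply: le_trans (gP n x); rewrite lee_fin; exact: Re_le_normc.
- apply: (Rdominated_cvg (F := fun J x => Im (P J x * conjc (chi x))) _ _ _ ig).
  + by move=> J; case: (cmeasurableM (mP J) mc).
  + by case: (cmeasurableM mf mc).
  + apply: filterS aeS => x /cvgP[h1 h2]; rewrite cImM.
    under eq_fun do rewrite cImM.
    by apply: cvgD; apply: cvgM => //; exact: cvg_cst.
  + move=> n x; apply: le_trans (gP n x); rewrite lee_fin; exact: Im_le_normc.
Qed.

End SumLp.

(** * Translations *)

Section Translations.
Variables (R : realType) (G : topologicalZmodType)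
  (m : probability (borel G) R).
Variable beta : R -> G.
Local Notation T := (borel G).
Local Notation L := (ln 2 : R).
Local Notation lam := (@freq R).

Hypothesis minv : forall (x : G) (B : set T), measurable B ->
  m ((fun y : G => x + y) @^-1` B) = m B.
Hypothesis dbeta : dense (range beta).
Variable h : nat -> G -> R[i].
Hypothesis hP : forall n, lift_freq beta (lam n) (h n).

Let hchar n : character (h n). Proof. by case: (hP n). Qed.

Let hinj : injective h.
Proof.
move=> n l e; have := hP l; rewrite -e => /(lift_freq_inj (hP n)).
exact: (inc_inj (le_mono (@freq_lt R))).
Qed.

Definition block (j : nat) : seq nat := index_iota (bnd j) (bnd j.+1).

Lemma trig_blocks c J x :
  \sum_(0 <= j < J) trig h (block j) c x = trig h (index_iota 0 (bnd J)) c x.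
Proof. by rewrite /trig sum_blocks. Qed.

(** Membership criterion: the block sums, weighted by 2^j, have p-th moments decaying like 2^(-j),
    so their series defines an L_p function. Each Fourier coefficient of the partial sums is
    eventually constant, which identifies the coefficients of the limit. *)
Lemma Hp_blocks (p : nat) (c : nat -> R[i]) (C : R) : (0 < p)%N -> 0 <= C ->
  (forall j, ((2 ^ j)%:R ^+ p) * \int[m]_x normc (trig h (block j) c x) ^+ p <=
     C * expR (- (L * j.+1%:R))) ->
  Hp m lam beta p%:R%:E c.
Proof.
move=> p0 C0 hC.
have QC j : (\int[m]_x ((((2 ^ j)%:R * normc (trig h (block j) c x)) ^+ p)%:E)
  <= (C / (2 ^ j.+1)%:R)%:E)%E.
  under eq_integral do rewrite exprMn EFinM.
  have iQ := trig_integrableX m hchar (block j) c p.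
  rewrite integralZl//= -[X in (_ * X)%E]fineK; last exact: integrable_fin_num.
  by rewrite -EFinM lee_fin -expR_LN; exact: hC.
have [f [mf fp hf]] :=
  series_Lp p0 (fun j => trig_cmeasurable hchar (block j) c) QC C0.
have hfJ chi : character chi ->
    Re (fourier m (trig h (index_iota 0 (bnd J)) c) chi) @[J --> \oo] -->
      Re (fourier m f chi) /\
    Im (fourier m (trig h (index_iota 0 (bnd J)) c) chi) @[J --> \oo] -->
      Im (fourier m f chi).
  move=> /hf.
  have E J : (fun x => \sum_(0 <= j < J) trig h (block j) c x) =
             trig h (index_iota 0 (bnd J)) c.
    by apply/funext => x; exact: trig_blocks.
  by under eq_fun do rewrite E; move=> [h1]; under eq_fun do rewrite E.
have eqlim (u : nat -> R) (a l : R) (N : nat) :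
    (forall J, (N <= J)%N -> u J = a) ->
    u J @[J --> \oo] --> l -> l = a.
  move=> ua ul; have : u J @[J --> \oo] --> a.
    by apply: cvg_near_cst; exists N => // J /= /ua ->.
  exact: cvg_unique ul.
have eqC (z w : R[i]) : Re z = Re w -> Im z = Im w -> z = w.
  by case: z => a b; case: w => a' b' /= -> ->.
exists f.
  split; first by apply/LpP.
  move=> chi hc hn; have [h1 h2] := hfJ chi hc.
  have hne n : h n <> chi by move=> e; apply: (hn n); rewrite -e.
  by apply: eqC; [apply: (eqlim _ _ _ 0%N) h1 => J _|apply: (eqlim _ _ _ 0%N)
    h2 => J _];
     rewrite fourier_trig_out.
move=> n chi hn; have -> : chi = h n by exact: lift_freq_uniq hn (hP n).
have [h1 h2] := hfJ (h n) (hchar n).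
(* J > n suffices for the first J blocks to contain n, since [bnd J] is at least J. *)
have tr J : (n.+1 <= J)%N ->
    fourier m (trig h (index_iota 0 (bnd J)) c) (h n) = c n.
  move=> nJ; rewrite fourier_trig_in ?iota_uniq// mem_index_iota /=.
  by rewrite (leq_trans nJ (leq_bnd J)).
by apply/esym/eqC; [apply: (eqlim _ _ _ n.+1) h1 => J /tr ->
                   |apply: (eqlim _ _ _ n.+1) h2 => J /tr ->].
Qed.

Lemma normc_sqr_block c (r : R) j : 0 <= r ->
  (forall n, n \in block j -> normc (c n) ^+ 2 <= r) ->
  \sum_(n <- block j) normc (c n) ^+ 2 <= (2 ^ (j.+1 ^ 3))%:R * r.
Proof.
move=> r0 cr; apply: (@le_trans _ _ (\sum_(n <- block j) r)).
  by rewrite !big_seq; apply: ler_sum.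
rewrite big_const_seq count_predT iter_addr addr0 -[leLHS]mulr_natl ler_wpM2r//.
by rewrite ler_nat size_iota bnd_size.
Qed.

(** On a block, Bessel and the damping factor bound the L_2 norm, and [nikolskii] converts this into
    an L_2k bound. The hypothesis on sigma makes the coefficient of Y^3 in the exponent nonpositive;
    positivity of sigma leaves a negative term in Y^2 that beats the weights. *)
Lemma Hp_translation (k : nat) (sigma : R) a : (0 < k)%N -> 0 < sigma ->
  (k%:R - 1) / (2 * k%:R) <= sigma -> Hp m lam beta 2%:E a ->
  Hp m lam beta (2 * k%:R)%:E (translation lam sigma a).
Proof.
move=> k0 s0 sk [f [/(LpP _ _ (isT : (0 < 2)%N))[mf f2] _] af].
have kp : 0 < k%:R :> R by rewrite ltr0n.
have Lp := ln2_gt0 R.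
have fi : cintegrable m f by exact: (cintegrable_Lp (isT : (0 < 2)%N) mf f2).
have aE n : a n = fourier m f (h n) by exact: af.
set F := \int[m]_x normc (f x) ^+ 2.
have F0 : 0 <= F by apply: Rintegral_ge0 => x _; exact: sqr_ge0.
pose tau := 2 * k%:R * sigma.
have tau0 : 0 < tau by rewrite !mulr_gt0.
have tauk : k%:R - 1 <= tau by rewrite /tau mulrC -ler_pdivrMr// mulr_gt0.
(* The maximum over Y of (2k+1) Y - tau Y^2, where the linear term gathers the weights and the decay
   demanded by [Hp_blocks]. *)
pose D := (2 * k%:R + 1) ^+ 2 / (4 * tau).
rewrite -natrM.
apply: (@Hp_blocks _ _ (expR (L * D) * F ^+ k)).
- by rewrite muln_gt0.
- by rewrite mulr_ge0 ?expR_ge0 ?exprn_ge0.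
move=> j; set c := translation _ _ _.
pose Y : R := j.+1%:R.
have Y1 : 1 <= Y by rewrite ler1n.
pose E := expR (- (2 * sigma * (L * (hgt j)%:R))).
have cE n : n \in block j -> normc (c n) ^+ 2 <=
  E * normc (fourier m f (h n)) ^+ 2.
  rewrite mem_index_iota => /blk_eq nj.
  rewrite /c /translation Normc.normcM normc_real ger0_norm ?expR_ge0//
    exprMn mulrC aE.
  rewrite ler_wpM2r ?sqr_ge0// -expRM_natr ler_expR mulNr lerN2 -nj.
  have /andP[l1 _] := freq_bounds R n.
  by rewrite -mulrA mulrC ler_pM2r// ler_pM2l.
have sumc : \sum_(n <- block j) normc (c n) ^+ 2 <= E * F.
  apply: (@le_trans _ _
    (\sum_(n <- block j) E * normc (fourier m f (h n)) ^+ 2)).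
    by rewrite !big_seq; apply: ler_sum => n /cE.
  by rewrite -mulr_sumr ler_pM2l ?expR_gt0//; apply: bessel => //;
    exact: iota_uniq.
have nik := nikolskii minv hchar hinj c (iota_uniq _ _ : uniq (block j)) k0.
have N1 : (size (block j))%:R <= expR (L * Y ^+ 3).
  by rewrite -natrX expR_L ler_nat size_iota bnd_size.
have bound : \int[m]_x normc (trig h (block j) c x) ^+ (2 * k) <=
    expR (L * Y ^+ 3) ^+ k.-1 * (E * F) ^+ k.
  apply: (le_trans nik); apply: ler_pM; rewrite ?exprn_ge0 ?sumr_ge0//.
  + by move=> n _; exact: sqr_ge0.
  + by rewrite lerXn2r ?nnegrE ?expR_ge0.
  + rewrite lerXn2r ?nnegrE ?mulr_ge0 ?expR_ge0 ?sumr_ge0// => n _;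
    exact: sqr_ge0.
apply: (@le_trans _ _
  ((2 ^ j)%:R ^+ (2 * k) * (expR (L * Y ^+ 3) ^+ k.-1 * (E * F) ^+ k))).
  by rewrite ler_wpM2l// exprn_ge0.
rewrite exprMn 2![X in X <= _]mulrA [leRHS]mulrAC ler_wpM2r ?exprn_ge0//.
rewrite -expR_L -!expRM_natr -!expRD ler_expR.
have -> : k.-1%:R = k%:R - 1 :> R by rewrite -[in RHS](prednK k0) -natr1 addrK.
have -> : (hgt j)%:R = Y ^+ 3 + Y ^+ 2 :> R by rewrite /hgt natrD !natrX.
have -> : j%:R = Y - 1 :> R by rewrite /Y -natr1 addrK.
rewrite natrM.
have -> : L * (Y - 1) * (2 * k%:R) + L * Y ^+ 3 * (k%:R - 1) +
   - (2 * sigma * (L * (Y ^+ 3 + Y ^+ 2))) * k%:R =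
   L * ((Y - 1) * (2 * k%:R) + Y ^+ 3 * (k%:R - 1) - tau * (Y ^+ 3 + Y ^+ 2)).
  by rewrite /tau; ring.
rewrite -mulrBr ler_pM2l//.
have q1 : (2 * k%:R + 1) * Y - tau * Y ^+ 2 <= D.
  have -> : D = (2 * k%:R + 1) * Y - tau * Y ^+ 2 +
    (2 * tau * Y - (2 * k%:R + 1)) ^+ 2 / (4 * tau).
    by rewrite /D; field; rewrite gt_eqF.
  by rewrite lerDl divr_ge0 ?sqr_ge0// mulr_ge0// ltW.
have q2 : Y ^+ 3 * (k%:R - 1) <= Y ^+ 3 * tau.
  by rewrite ler_wpM2l// exprn_ge0// (le_trans ler01).
by lra.
Qed.

(** In an arithmetic progression both products carry the same total frequency, so they agree on the
    dense image of [beta], hence everywhere. *)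
Lemma character_shift i r r' x :
  (bnd i + r < bnd i.+1)%N -> (bnd i + r' < bnd i.+1)%N ->
    (bnd i + r + r' < bnd i.+1)%N ->
  h (bnd i + r) x * h (bnd i + r') x = h (bnd i) x * h (bnd i + r + r') x.
Proof.
move=> h1 h2 h12; move: x.
have cc n : continuous (h n : G -> R[i]^o) by case: (hchar n).
apply: (dense_eqc dbeta (continuousMc (cc _) (cc _))
  (continuousMc (cc _) (cc _))).
move=> _ [t _ <-]; rewrite (lift_freqM (hP _) (hP _))
  (lift_freqM (hP _) (hP _)).
congr (expi (- (_ * t))); rewrite -(addnA (bnd i)).
have h0 : (bnd i + 0 < bnd i.+1)%N by rewrite addn0 bnd_lt.
rewrite -{3}(addn0 (bnd i)) !freqE ?addnA// natrD mul0r.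
by rewrite -!mulrDr mulrDl; congr (_ * _); ring.
Qed.

(* The square of the Dirichlet kernel of the block, rotated by a character of
   modulus 1, is a trigonometric polynomial with frequencies in the block. *)
Lemma fejer_test (k i : nat) (g : T -> R[i]) (t w : R) : (0 < k)%N ->
  cmeasurable g ->
  m.-integrable setT (EFin \o (fun x => normc (g x) ^+ (2 * k))) ->
  let M := (2 ^ (i.+1 ^ 3 - 2))%N in
  0 < t -> M%:R <= t ^+ (2 * k) ->
  (forall n, n \in block i -> w <= Re (fourier m g (h n))) ->
  M%:R * w <= t * (\int[m]_x normc (g x) ^+ (2 * k) + 1).
Proof.
move=> k0 mg g2k M t0 tM hw; have M0 : (0 < M)%N by rewrite expn_gt0.
have k20 : (0 < 2 * k)%N by rewrite muln_gt0.
have Mp : 0 < M%:R :> R by rewrite ltr0n.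
have gi := cintegrable_Lp k20 mg g2k.
set Gam := \int[m]_x _.
pose B := bnd i.
have room j : (j < M.*2.-1)%N -> (B + j < bnd i.+1)%N.
  by move=> jM; have := bnd_room i; rewrite -/M -/B; lia.
pose D := trig h (iota B M) (fun=> 1).
(* Listing u + v with repetition makes [h B * K] equal to the square of [D], hence |K| = |D|^2. *)
pose s := [seq (B + u + v)%N | u <- iota 0 M, v <- iota 0 M].
pose K := trig h s (fun=> 1).
have normK x : normc (K x) = normc (D x) ^+ 2.
  have DE : D x = \sum_(u <- iota 0 M) h (B + u) x.
    rewrite /D /trig -[B in iota B M]addn0 iotaDl big_map.
    by apply: eq_bigr => u _; rewrite mul1r.
  have KE : h B x * K x = D x * D x.
    rewrite DE big_distrlr /= /K /trig big_allpairs_dep /= mulr_sumr.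
    apply: eq_big_seq => u; rewrite mem_iota add0n /= => uM.
    rewrite mulr_sumr; apply: eq_big_seq => v; rewrite mem_iota add0n /= => vM.
    rewrite mul1r character_shift//.
    + by apply: room; lia.
    + by apply: room; lia.
    + by rewrite -addnA; apply: room; lia.
  rewrite -[LHS]mul1r -(normc_character x (hchar B)) -Normc.normcM KE.
  by rewrite Normc.normcM expr2.
have normD x : normc (D x) <= M%:R.
  apply: le_trans (trig_le hchar _ _ _) _.
  by rewrite big_const_seq count_predT size_iota iter_addr addr0 Normc.normc1.
have lower : M%:R ^+ 2 * w <= Re (cintegral m (fun x => g x * conjc (K x))).
  rewrite (cintegral_trigJ hchar s (fun=> 1) gi mg) cRe_sum.
  have -> : M%:R ^+ 2 * w = \sum_(n <- s) w.
    rewrite big_const_seq count_predT iter_addr addr0 -[RHS]mulr_natl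
      size_allpairs.
    by rewrite !size_iota natrM expr2.
  rewrite !big_seq; apply: ler_sum => n /allpairsP[[u v] [+ + ->]].
  rewrite !mem_iota !add0n => /andP[_ uM] /andP[_ vM].
  rewrite conjc1 mul1r; apply: hw; rewrite mem_index_iota.
  by rewrite -addnA leq_addr /=; apply: room; move: uM vM; rewrite /=; lia.
pose q : R := M%:R ^+ 2 / t ^+ (2 * k).-1.
have q0 : 0 <= q by rewrite divr_ge0 ?sqr_ge0// exprn_ge0// ltW.
(* Splitting at level t replaces Hoelder's inequality: below t, bound y by t; above t, bound d by
   M^2 and y by y^(2k) / t^(2k-1). *)
have young y d : 0 <= y -> 0 <= d -> d <= M%:R ^+ 2 ->
    y * d <= q * y ^+ (2 * k) + t * d.
  move=> y0 d0 dM; have [yt|ty] := leP y t.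
    apply: (@le_trans _ _ (t * d)); first by rewrite ler_wpM2r.
    by rewrite lerDr mulr_ge0// exprn_ge0.
  apply: (@le_trans _ _ (q * y ^+ (2 * k)));
    last by rewrite lerDl mulr_ge0// ltW.
  apply: (@le_trans _ _ (M%:R ^+ 2 * y)); first by rewrite mulrC ler_wpM2r.
  have -> : q * y ^+ (2 * k) = M%:R ^+ 2 * (y ^+ (2 * k) / t ^+ (2 * k).-1).
    by rewrite /q; ring.
  rewrite ler_wpM2l ?sqr_ge0// ler_pdivlMr ?exprn_gt0//.
  by rewrite -[in leRHS](prednK k20) exprS ler_wpM2l// lerXn2r ?nnegrE// ltW.
have iK : m.-integrable setT (EFin \o (fun x => Re (g x * conjc (K x)))).
  by case: (cintegrable_MJ_trig hchar s (fun=> 1) gi mg).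
have i1 : m.-integrable setT (EFin \o (fun x => q * normc (g x) ^+ (2 * k))).
  exact: integrable_mulr.
have i2 : m.-integrable setT (EFin \o (fun x => t * normc (D x) ^+ 2)).
  by apply: integrable_mulr; exact: trig_integrableX.
have upper : Re (cintegral m (fun x => g x * conjc (K x))) <=
  q * Gam + t * M%:R.
  have -> : M%:R = \int[m]_x normc (D x) ^+ 2.
    rewrite (parseval minv hchar hinj _ (iota_uniq B M)).
    rewrite big_const_seq count_predT iter_addr addr0 Normc.normc1 expr1n.
    by rewrite size_iota.
  rewrite -!RintegralZl//; last exact: trig_integrableX.
  rewrite -RintegralD//=; apply: le_Rintegral => //.
    exact: (integrableD measurableT i1 i2).
  move=> x _; apply: le_trans (ler_norm _) _; apply: le_trans (Re_le_normc _) _.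
  rewrite Normc.normcM normc_conjc normK; apply: young;
    rewrite ?normc_ge0 ?sqr_ge0//.
  by rewrite lerXn2r ?nnegrE ?normc_ge0.
(* This is where M <= t^(2k) enters: both parts of the splitting become of size t M. *)
have qt : q <= t * M%:R.
  rewrite /q ler_pdivrMr ?exprn_gt0// -mulrA mulrCA -exprS prednK//.
  by rewrite expr2 ler_pM2l.
have := le_trans lower upper.
have : q * Gam <= t * M%:R * Gam.
  rewrite ler_wpM2r//; apply: Rintegral_ge0 => x _; rewrite exprn_ge0//.
  exact: normc_ge0.
move=> h1 h2; rewrite -(ler_pM2l Mp).
apply: (@le_trans _ _ (M%:R ^+ 2 * w)); first by rewrite expr2 mulrA.
apply: (le_trans h2); rewrite mulrCA [X in _ <= X]mulrA mulrDr mulr1.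
by rewrite lerD2r.
Qed.

Lemma not_Hp_translation (k : nat) (sigma : R) : (0 < k)%N ->
  sigma < (k%:R - 1) / (2 * k%:R) ->
  exists2 a, Hp m lam beta 2%:E a &
    ~ Hp m lam beta (2 * k%:R)%:E (translation lam sigma a).
Proof.
move=> k0 sk; have kp : 0 < k%:R :> R by rewrite ltr0n.
have Lp := ln2_gt0 R.
pose Y (i : nat) : R := i.+1%:R.
(* The exponent Y^3 / 2 compensates the number of terms of the block in the L_2 norm; 2 Y yields a
   factor 2^(-4Y) in its square, enough against the weight 4^j and the required decay 2^(-Y). *)
pose r (i : nat) : R := expR (- (L * (Y i ^+ 3 / 2 + 2 * Y i))).
pose a (n : nat) : R[i] := (r (blk n))%:C%C.
have aE n : normc (a n) = r (blk n) by rewrite normc_real ger0_norm ?expR_ge0.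
exists a.
  apply: (@Hp_blocks 2 a 1) => // j.
  rewrite (parseval minv hchar hinj a (iota_uniq _ _ : uniq (block j))) mul1r.
  apply: (@le_trans _ _ ((2 ^ j)%:R ^+ 2 * ((2 ^ (j.+1 ^ 3))%:R * r j ^+ 2))).
    rewrite ler_wpM2l ?sqr_ge0//; apply: normc_sqr_block; first exact: sqr_ge0.
    by move=> n; rewrite mem_index_iota => /blk_eq nj; rewrite aE nj.
  rewrite -!expR_L -!expRM_natr -!expRD ler_expR natrX -/(Y j).
  have -> : j%:R = Y j - 1 :> R by rewrite /Y -natr1 addrK.
  have Y1 : 1 <= Y j by rewrite ler1n.
  have -> : L * (Y j - 1) * 2 +
    (L * Y j ^+ 3 + - (L * (Y j ^+ 3 / 2 + 2 * Y j)) * 2) =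
     - (L * (2 * Y j + 2)) by field.
  by rewrite lerN2 ler_pM2l//; lra.
rewrite -natrM => -[g [gLp _] ga].
have k20 : (0 < 2 * k)%N by rewrite muln_gt0.
have [mg g2k] := (LpP m g k20).1 gLp.
have gi := cintegrable_Lp k20 mg g2k.
have gE n : fourier m g (h n) = (r (blk n) * expR (- (sigma * lam n)))%:C%C.
  by rewrite -(ga n _ (hP n)) /translation rmorphM.
set Gam := \int[m]_x normc (g x) ^+ (2 * k).
have Gam0 : 0 <= Gam by apply: Rintegral_ge0 => x _;
  rewrite exprn_ge0// normc_ge0.
(* [fejer_test] with t = 2^(Y^3 / 2k), so that t^(2k) = 2^(Y^3) is at least M. The term [|sigma|]
   accounts for the variation of the frequency inside the block, whatever the sign of sigma. *)
have test i : expR (L * (Y i ^+ 3 - 2)) * r i *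
    expR (- (L * (sigma * (hgt i)%:R + `|sigma|))) <=
    expR (L * (Y i ^+ 3 / (2 * k%:R))) * (Gam + 1).
  pose M := (2 ^ (i.+1 ^ 3 - 2))%N.
  have MY : expR (L * (Y i ^+ 3 - 2)) <= M%:R.
    rewrite -expR_L ler_expR ler_pM2l// lerBlDr /Y -natrX -natrD ler_nat.
    by rewrite addnC -leq_subLR.
  pose w := r i * expR (- (L * (sigma * (hgt i)%:R + `|sigma|))).
  have w0 : 0 <= w by rewrite mulr_ge0 ?expR_ge0.
  rewrite -mulrA -/w; apply: (@le_trans _ _ (M%:R * w));
    first by rewrite ler_wpM2r.
  apply: (fejer_test k0 mg g2k); first exact: expR_gt0.
    rewrite -expRM_natr natrM -mulrA divfK ?mulf_neq0 ?gt_eqF//.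
    by rewrite /Y -natrX expR_L ler_nat leq_exp2l// leq_subr.
  move=> n; rewrite mem_index_iota => /blk_eq nj; rewrite gE /= nj.
  rewrite ler_wpM2l ?expR_ge0// ler_expR lerN2.
  have /andP[l1 /ltW l2] := freq_bounds R n; rewrite nj in l1 l2.
  have : sigma * (lam n - L * (hgt i)%:R) <= `|sigma| * L.
    apply: (@le_trans _ _ (`|sigma| * (lam n - L * (hgt i)%:R))).
      by rewrite ler_wpM2r ?subr_ge0// ler_norm.
    by rewrite ler_wpM2l// lerBlDl -[X in _ + X]mulr1 -mulrDr.
  by rewrite mulrBr lerBlDl => /le_trans; apply;
    rewrite mulrDr mulrCA [X in _ + X]mulrC.
pose alpha := (k%:R - 1) / (2 * k%:R) - sigma.
have al0 : 0 < alpha by rewrite subr_gt0.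
(* For this block alpha Y^3 exceeds every lower order term by at least (Gam + 1) / [ln 2]; then
   exp(z) >= 1 + z with z = Gam + 1 contradicts [test]. *)
pose i := Num.trunc (((Gam + 1) / L + 3 * `|sigma| + 4) / alpha).
have iP : (Gam + 1) / L + 3 * `|sigma| + 4 <= Y i * alpha.
  by rewrite -ler_pdivrMr// ltW// truncnS_gt.
have := test i; rewrite /r -!expRD leNgt => /negP; apply.
have Y1 : 1 <= Y i by rewrite ler1n.
have hE : (hgt i)%:R = Y i ^+ 3 + Y i ^+ 2 :> R by rewrite /hgt natrD !natrX.
rewrite mulrC -ltr_pdivlMr ?expR_gt0// -expRN -expRD.
apply: (@lt_le_trans _ _ (1 + (Gam + 1))); first by rewrite ltrDr.
apply: le_trans (expR_ge1Dx _) _; rewrite ler_expR hE.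
have -> : L * (Y i ^+ 3 - 2) + - (L * (Y i ^+ 3 / 2 + 2 * Y i)) +
    - (L * (sigma * (Y i ^+ 3 + Y i ^+ 2) + `|sigma|)) -
    L * (Y i ^+ 3 / (2 * k%:R)) =
    (Y i ^+ 3 * alpha - sigma * Y i ^+ 2 - 2 * Y i - 2 - `|sigma|) * L.
  by rewrite /alpha; field; rewrite gt_eqF.
rewrite -ler_pdivrMr//.
have Y2 : 1 <= Y i ^+ 2 by rewrite exprn_ege1.
have Y12 : Y i <= Y i ^+ 2 by rewrite expr2 ler_peMr// (le_trans ler01).
have d1 : sigma * Y i ^+ 2 <= `|sigma| * Y i ^+ 2.
  by rewrite ler_wpM2r ?ler_norm// (le_trans ler01).
have d2 : `|sigma| <= `|sigma| * Y i ^+ 2 by rewrite ler_peMr.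
have d3 : (Gam + 1) / L <= (Gam + 1) / L * Y i ^+ 2.
  by rewrite ler_peMr// divr_ge0 ?addr_ge0// ltW.
have d4 : ((Gam + 1) / L + 3 * `|sigma| + 4) * Y i ^+ 2 <= Y i ^+ 3 * alpha.
  have -> : Y i ^+ 3 * alpha = Y i * alpha * Y i ^+ 2 by ring.
  by rewrite ler_wpM2r// (le_trans ler01).
have d5 : 0 <= `|sigma| by [].
move: d1 d2 d3 d4; rewrite !mulrDl.
move: ((Gam + 1) / L) (Y i ^+ 3 * alpha) (sigma * _) => A3 A4 A5; lra.
Qed.

End Translations.

Theorem theorem5p11 (R : realType) :
  exists lam : nat -> R, [/\ frequency lam, BC lam &
    forall k : nat, (1 <= k)%N ->
      A lam k = ((k%:R - 1) / (2 * k%:R))%:E /\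
      (* $\mathcal H_p(\lambda)$ does not depend on the Dirichlet group *)
      forall (G : topologicalZmodType) (m : probability (borel G) R)
          (beta : R -> G),
        haar m -> dirichlet_group lam beta ->
        forall sigma : R,
          translation lam sigma @` Hp m lam beta 2%:E
            `<=` Hp m lam beta (2 * k%:R)%:E
          <-> (k%:R - 1) / (2 * k%:R) <= sigma].
Proof.
exists (@freq R); split; [exact: frequency_freq|exact: BC_freq|move=> k k0].
split; first exact: A_freq.
move=> G m beta [minv _ _] [_ _ dbeta /choice[h hP]] sigma.
have kp : 0 < k%:R :> R by rewrite ltr0n.
split=> [incl|sk].
  rewrite leNgt; apply/negP => sk.
  have [a a2] := not_Hp_translation minv dbeta hP k0 sk.
  by apply; apply: incl; exists a.
move=> _ [a a2 <-].
have c0 : 0 <= (k%:R - 1) / (2 * k%:R) :> R.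
  by rewrite divr_ge0 ?mulr_ge0// subr_ge0 ler1n.
have [s0|s0] := ltP 0 sigma; first exact: (Hp_translation minv dbeta hP).
(* The remaining case is sigma = 0, which forces k = 1: the translation is the identity and both
   spaces are H_2. *)
have sigma0 : sigma = 0 by apply/eqP; rewrite eq_le s0 (le_trans c0).
have -> : translation (@freq R) sigma a = a.
  by apply/funext => n; rewrite /translation sigma0 mul0r oppr0 expR0 mulr1.
have -> : k%:R = 1 :> R.
  apply/eqP; rewrite -subr_eq0; apply/eqP.
  have : (k%:R - 1) / (2 * k%:R) = 0 :> R.
    by apply/eqP; rewrite eq_le c0 andbT -sigma0.
  by move/eqP; rewrite mulf_eq0 invr_eq0 mulf_eq0 !pnatr_eq0 /=
    (gtn_eqF k0) orbF => /eqP.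
by rewrite mulr1.
Qed.
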